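(* Let $n\ge 2$, let $X_1,\dots,X_n$ be complex Banach spaces, and let $D_1\in\mathcal{B}(X_1),\ D_2\in\mathcal{B}(X_2),\dots,D_n\in\mathcal{B}(X_n)$. Assume that $D_s-\lambda$ is regular for every $2\le s\le n-1$ and every $\lambda\in\mathbb{C}$. Then $$\bigcap_{A\in\mathcal{B}_n}\sigma_r(T_n^d(A))\subseteq\sigma_r(D_n)\cup\Big(\bigcup_{k=1}^{n-1}\Delta_k'\Big)\cup\Delta'',$$ where $$\Delta_k'=\{\lambda\in\mathbb{C}:\ \mathcal{K}(D_k-\lambda)\preceq\mathcal{N}(D_{k+1}-\lambda)\text{ does not hold}\},\quad 1\le k\le n-1,$$ $$\Delta''=\{\lambda\in\mathbb{C}:\ D_1-\lambda\text{ is not regular}\}.$$ If moreover $X_1,\dots,X_n$ are infinite dimensional Hilbert spaces, then $$\sigma_r(D_n)\cup\Big(\bigcup_{k=1}^{n-1}\Delta_k\Big)\subseteq\bigcap_{A\in\mathcal{B}_n}\sigma_r(T_n^d(A)),$$ where $$\Delta_k=\Big\{\lambda\in\mathbb{C}:\ \bigoplus_{s=k+1}^{n}\mathcal{N}(D_s-\lambda)\prec\mathcal{K}(D_k-\lambda)\text{ holds}\Big\},\quad 1\le k\le n-1.$$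
   Context: For Banach spaces $X,Y$, $\mathcal{B}(X,Y)$ is the set of bounded linear operators from $X$ to $Y$, and $\mathcal{B}(X)=\mathcal{B}(X,X)$. $\mathcal{N}(T)$ and $\mathcal{R}(T)$ denote the kernel and the range of $T$. $D-\lambda$ means $D-\lambda I$. No separability is assumed. Given $D_i\in\mathcal{B}(X_i)$, $1\le i\le n$, let $\mathcal{B}_n$ be the set of all tuples $A=(A_{ij})_{1\le i<j\le n}$ with $A_{ij}\in\mathcal{B}(X_j,X_i)$. For $A\in\mathcal{B}_n$, $T_n^d(A)\in\mathcal{B}(X_1\oplus\cdots\oplus X_n)$ is the upper triangular $n\times n$ operator matrix with diagonal entries $D_1,\dots,D_n$, with $(i,j)$ entry $A_{ij}$ for $i<j$, and with $(i,j)$ entry $0$ for $i>j$. An operator $T\in\mathcal{B}(X,Y)$ is left (right) invertible if $ST=I$ ($TS=I$) for some $S\in\mathcal{B}(Y,X)$. $\mathcal{G}_r(X)$ is the set of right invertible operators in $\mathcal{B}(X)$. The right spectrum of $T\in\mathcal{B}(X)$ is $\sigma_r(T)=\{\lambda\in\mathbb{C}:\lambda-T\notin\mathcal{G}_r(X)\}$. $T\in\mathcal{B}(X)$ is (inner) regular if $T=T\widetilde{T}T$ for some $\widetilde{T}\in\mathcal{B}(X)$; equivalently, $\mathcal{N}(T)$ and $\mathcal{R}(T)$ are closed and complemented subspaces of $X$. For $T\in\mathcal{B}(X)$ such that $\overline{\mathcal{R}(T)}$ is complemented in $X$, $\mathcal{K}(T)$ denotes a topological complement of $\overline{\mathcal{R}(T)}$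 in $X$ (unique up to isomorphism; in a Hilbert space one may take $\mathcal{R}(T)^\perp$). In the first inclusion, any $\lambda$ for which $\mathcal{K}(D_1-\lambda)$ does not exist lies in $\Delta''$, so how $\Delta_1'$ is read at such $\lambda$ is immaterial. For Banach spaces $X,Y$, write $X\preceq Y$ if there is a left invertible operator from $X$ to $Y$. Write $X\prec Y$ if $X\preceq Y$ and $Y/\mathcal{R}(T)$ is an infinite dimensional linear space for every $T\in\mathcal{B}(X,Y)$. (If $X,Y$ are Hilbert spaces, then $X\preceq Y$ iff $\dim X\le\dim Y$, and $X\prec Y$ iff $\dim X<\dim Y$ and $\dim Y=\infty$, where $\dim$ is the orthogonal dimension.) *)

(* Defs.v *)
From HB Require Import structures.
From mathcomp Require Import all_boot all_order all_algebra.
From mathcomp Require Import generic_quotient ring_quotient sesquilinear complex.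
From mathcomp Require Import all_classical all_reals topology normedtype.

Set Implicit Arguments.
Unset Strict Implicit.
Unset Printing Implicit Defensive.

Import Order.TTheory GRing.Theory Num.Theory.
Import numFieldNormedType.Exports.
Local Open Scope classical_set_scope.
Local Open Scope ring_scope.

Section BoundedOperators.
Context {F : numFieldType}.

Definition op_bounded (X Y : normedModType F) (f : X -> Y) : Prop :=
  exists r : F, forall x, `|f x| <= r * `|x|.

(* B(X, Y).  The bound [r] lies in the scalar field; it is automatically real
   as soon as [X] is nonzero. *)
Record bop (X Y : normedModType F) := Bop {
  bop_fun :> {linear X -> Y};
  bopP : op_bounded bop_fun }.

Definition left_invertible (X Y : normedModType F) (T : bop X Y) : Prop :=
  exists S : bop Y X, forall x, S (T x) = x.

Definition right_invertible (X Y : normedModType F) (T : bop X Y) : Prop :=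
  exists S : bop Y X, forall y, T (S y) = y.

Definition regular (X : normedModType F) (T : bop X X) : Prop :=
  exists S : bop X X, forall x, T (S (T x)) = T x.

Section Shift.
Variables (X : normedModType F) (T : bop X X) (l : F).

Lemma sub_scalar_bounded : op_bounded (T \- l \*: idfun).
Proof.
have [r rT] := bopP T; exists (r + `|l|) => x /=.
by rewrite mulrDl (le_trans (ler_normB _ _)) // lerD // normrZ.
Qed.

(* T - l *)
Definition sub_scalar : bop X X := Bop sub_scalar_bounded.

Lemma scalar_sub_bounded : op_bounded (l \*: idfun \- T).
Proof.
have [r rT] := bopP T; exists (`|l| + r) => x /=.
by rewrite mulrDl (le_trans (ler_normB _ _)) // lerD // normrZ.
Qed.

(* l - T *)
Definition scalar_sub : bop X X := Bop scalar_sub_bounded.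

End Shift.

Definition right_spectrum (X : normedModType F) (T : bop X X) : set F :=
  [set l | ~ right_invertible (scalar_sub T l)].

End BoundedOperators.

Section Subspaces.
Context {F : numFieldType}.

(* A linear subspace with the norm of the ambient space; a Banach space when
   the ambient space is one and the subspace is closed. *)
Definition subspace_of (X : normedModType F) (U : submodClosed X) : Type :=
  {x : X | x \in U}.

Section SubspaceNormed.
Variables (X : normedModType F) (U : submodClosed X).
HB.instance Definition _ := SubChoice.on (subspace_of U).
HB.instance Definition _ :=
  [SubChoice_isSubLmodule of subspace_of U by <:].

Let norm (x : subspace_of U) : F := `|val x|.
Let norm_triangle x y : norm (x + y) <= norm x + norm y.
Proof. by rewrite /norm raddfD ler_normD. Qed.
Let normZ l x : norm (l *: x) = `|l| * norm x.
Proof. by rewrite /norm linearZ /= normrZ. Qed.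
Let norm_eq0 x : norm x = 0 -> x = 0.
Proof. by move=> /normr0_eq0 x0; apply/val_inj; rewrite x0 raddf0. Qed.
HB.instance Definition _ :=
  Lmodule_isNormed.Build F (subspace_of U) norm_triangle normZ norm_eq0.
End SubspaceNormed.

Section KernelRange.
Variables (X Y : normedModType F) (T : bop X Y).

Definition kernel : {pred X} := [pred x | T x == 0].

Lemma kernel_submod : submod_closed kernel.
Proof.
split=> [|l x y]; rewrite !inE ?linear0 // => /eqP x0 /eqP y0.
by rewrite linearP x0 y0 scaler0 addr0.
Qed.
HB.instance Definition _ := GRing.isSubmodClosed.Build F X kernel kernel_submod.

Definition oprange : {pred Y} := [pred y | y \in range T].

Lemma oprange_submod : submod_closed oprange.
Proof.
split=> [|l x y]; rewrite !inE /=; first by exists 0; rewrite ?linear0.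
by move=> [u _ <-] [v _ <-]; exists (l *: u + v); rewrite ?linearP.
Qed.
HB.instance Definition _ :=
  GRing.isSubmodClosed.Build F Y oprange oprange_submod.
End KernelRange.

End Subspaces.

Section QuotientSpace.
Context {F : numFieldType} (V : lmodType F) (U : submodClosed V).
Local Open Scope quotient_scope.

Definition submod_pred : {pred V} := [pred x | x \in U].

Lemma submod_pred_zmod : zmod_closed submod_pred.
Proof.
split=> [|x y]; rewrite !inE ?rpred0 // => xU yU.
by rewrite -scaleN1r rpredD // rpredZ.
Qed.
HB.instance Definition _ := GRing.isZmodClosed.Build V submod_pred
  submod_pred_zmod.

Definition quotient_space : Type := Quotient.quot submod_pred.
HB.instance Definition _ := GRing.Zmodule.on quotient_space.

Let pi (v : V) : quotient_space := \pi_(Quotient.quot submod_pred) v.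
Let scale (l : F) (x : quotient_space) : quotient_space :=
  pi (l *: repr (x : Quotient.quot submod_pred)).

Let piD u v : pi (u + v) = pi u + pi v.
Proof. exact: (raddfD (\pi_(Quotient.quot submod_pred))). Qed.

Let piP u v : u - v \in U -> pi u = pi v.
Proof. by move=> uvU; apply/eqP; rewrite -Quotient.idealrBE. Qed.

Let scaleE l v : scale l (pi v) = pi (l *: v).
Proof.
apply: piP; rewrite -scalerBr rpredZ // -[_ \in U]/(_ \in submod_pred).
by rewrite Quotient.idealrBE reprK.
Qed.

Let piS (x : quotient_space) : exists v, x = pi v.
Proof. by exists (repr (x : Quotient.quot submod_pred)); rewrite /pi reprK. Qed.

Let scaleA a b x : scale a (scale b x) = scale (a * b) x.
Proof. by have [v ->] := piS x; rewrite !scaleE scalerA. Qed.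
Let scale1 : left_id 1 scale.
Proof. by move=> x; have [v ->] := piS x; rewrite scaleE scale1r. Qed.
Let scaleDr : right_distributive scale +%R.
Proof.
move=> a x y; have [u ->] := piS x; have [v ->] := piS y.
by rewrite -piD !scaleE scalerDr piD.
Qed.
Let scaleDl x : {morph scale^~ x : a b / a + b}.
Proof. by move=> a b; have [v ->] := piS x; rewrite !scaleE scalerDl piD. Qed.
HB.instance Definition _ := GRing.Zmodule_isLmodule.Build F quotient_space
  scaleA scale1 scaleDr scaleDl.
End QuotientSpace.

Section DirectSum.
Context {F : numFieldType} {I : finType}.

(* A finite direct sum, with the norm sum_i |x_i|.  For Hilbert spaces this is
   equivalent to the l^2 norm, and right invertibility, [preceq] and [prec]
   depend on the norm only up to equivalence. *)
Definition direct_sum (X : I -> normedModType F) : Type := forall i, X i.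

Section DirectSumNormed.
Variable X : I -> normedModType F.
Implicit Types x y z : direct_sum X.

HB.instance Definition _ := gen_eqMixin (direct_sum X).
HB.instance Definition _ := gen_choiceMixin (direct_sum X).

Let add x y : direct_sum X := fun i => x i + y i.
Let opp x : direct_sum X := fun i => - x i.
Let zero : direct_sum X := fun=> 0.
Let scale (l : F) x : direct_sum X := fun i => l *: x i.

Let addA : associative add.
Proof. by move=> x y z; apply: functional_extensionality_dep => i; exact: addrA. Qed.
Let addC : commutative add.
Proof. by move=> x y; apply: functional_extensionality_dep => i; exact: addrC. Qed.
Let add0 : left_id zero add.
Proof. by move=> x; apply: functional_extensionality_dep => i; exact: add0r. Qed.
Let addN : left_inverse zero opp add.
Proof. by move=> x; apply: functional_extensionality_dep => i; exact: addNr. Qed.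
HB.instance Definition _ :=
  GRing.isZmodule.Build (direct_sum X) addA addC add0 addN.

Let scaleA a b x : scale a (scale b x) = scale (a * b) x.
Proof. by apply: functional_extensionality_dep => i; exact: scalerA. Qed.
Let scale1 : left_id 1 scale.
Proof. by move=> x; apply: functional_extensionality_dep => i; exact: scale1r. Qed.
Let scaleDr : right_distributive scale +%R.
Proof. by move=> a x y; apply: functional_extensionality_dep => i; exact: scalerDr. Qed.
Let scaleDl x : {morph scale^~ x : a b / a + b}.
Proof. by move=> a b; apply: functional_extensionality_dep => i; exact: scalerDl. Qed.
HB.instance Definition _ := GRing.Zmodule_isLmodule.Build F (direct_sum X)
  scaleA scale1 scaleDr scaleDl.

Let norm x : F := \sum_i `|x i|.
Let norm_triangle x y : norm (x + y) <= norm x + norm y.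
Proof. by rewrite -big_split ler_sum // => i _; exact: ler_normD. Qed.
Let normZ l x : norm (l *: x) = `|l| * norm x.
Proof. by rewrite mulr_sumr; apply: eq_bigr => i _; exact: normrZ. Qed.
Let norm_eq0 x : norm x = 0 -> x = 0.
Proof.
move=> /eqP; rewrite psumr_eq0 // => /allP x0.
apply: functional_extensionality_dep => i; apply/normr0_eq0/eqP.
by apply: x0; rewrite mem_index_enum.
Qed.
HB.instance Definition _ :=
  Lmodule_isNormed.Build F (direct_sum X) norm_triangle normZ norm_eq0.

Lemma direct_sum_normE x : `|x| = \sum_i `|x i|. Proof. by []. Qed.
End DirectSumNormed.
End DirectSum.

Section UpperTriangular.
Context {F : numFieldType} {n : nat}.
Variables (X : 'I_n -> normedModType F) (D : forall i, bop (X i) (X i)).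

(* The indices 0, ..., n - 1 stand for 1, ..., n. *)
Definition upper_entries : Type :=
  forall i j : 'I_n, (i < j)%N -> bop (X j) (X i).

Variable A : upper_entries.

Definition utriangular_fun (x : direct_sum X) : direct_sum X := fun i =>
  D i (x i) + \sum_(j : {j : 'I_n | (i < j)%N}) A (valP j) (x (val j)).

Lemma utriangular_linear : linear utriangular_fun.
Proof.
move=> l x y; apply: functional_extensionality_dep => i.
rewrite [LHS]/utriangular_fun.
under eq_bigr do rewrite linearP.
by rewrite linearP big_split /= -scaler_sumr addrACA -scalerDr.
Qed.
HB.instance Definition _ := GRing.isLinear.Build F (direct_sum X) (direct_sum X)
  *:%R utriangular_fun utriangular_linear.

Lemma utriangular_bounded : op_bounded utriangular_fun.
Proof.
have bnd (Y Z : normedModType F) (T : bop Y Z) :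
    {r : F | 0 <= r & forall x, `|T x| <= r * `|x|}.
  apply: cid2; have [r rT] := bopP T; exists `|r| => // x.
  have := ger0_norm (le_trans (normr_ge0 _) (rT x)).
  by rewrite normrM normr_id => ->.
pose d i := s2val (bnd _ _ (D i)).
pose a (i j : 'I_n) (ij : (i < j)%N) := s2val (bnd _ _ (A ij)).
have coord (x : direct_sum X) i : `|x i| <= `|x|.
  by rewrite direct_sum_normE (bigD1 i) //= lerDl sumr_ge0.
exists (\sum_i (d i + \sum_(j : {j : 'I_n | (i < j)%N}) a i _ (valP j))) => x.
rewrite {1}direct_sum_normE mulr_suml ler_sum // => i _.
rewrite (le_trans (ler_normD _ _)) // mulrDl lerD //.
  rewrite (le_trans (s2valP' (bnd _ _ (D i)) _)) //.
  by apply: ler_wpM2l => //; case: (bnd _ _ (D i)).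
rewrite (le_trans (ler_norm_sum _ _ _)) // mulr_suml ler_sum // => j _.
rewrite (le_trans (s2valP' (bnd _ _ (A (valP j))) _)) //.
by apply: ler_wpM2l => //; case: (bnd _ _ (A (valP j))).
Qed.

Definition utriangular : bop (direct_sum X) (direct_sum X) :=
  Bop utriangular_bounded.

End UpperTriangular.

Section Comparison.
Context {F : numFieldType}.

Definition infinite_dim (V : lmodType F) : Prop :=
  ~ exists (d : nat) (b : 'I_d -> V),
      forall v, exists c : 'I_d -> F, v = \sum_i c i *: b i.

(* [preceq] and [prec] are used for Banach spaces only: closed subspaces of
   Banach spaces and finite direct sums of them. *)
Definition preceq (X Y : normedModType F) : Prop :=
  exists T : bop X Y, left_invertible T.

Definition prec (X Y : normedModType F) : Prop :=
  preceq X Y /\ forall T : bop X Y, infinite_dim (quotient_space (oprange T)).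

(* For a closed subspace [W] of a Banach space: X is the algebraic direct sum
   of [W] and the closed subspace [M]. *)
Definition topological_complement (X : normedModType F) (W : set X)
    (M : submodClosed X) : Prop :=
  [/\ closed [set` M],
      forall x, exists w m, [/\ W w, m \in M & x = w + m] &
      forall x, W x -> x \in M -> x = 0].

Definition complemented (X : normedModType F) (W : set X) : Prop :=
  exists M : submodClosed X, topological_complement W M.

End Comparison.

(* The norm comes from an inner product, linear in its first argument. *)
Definition is_hilbert (R : realType) (X : completeNormedModType R[i]) : Prop :=
  exists f : {dot X for Num.conj}, forall x : X, `|x| ^+ 2 = f x x.

Section DeltaSets.
Context {F : numFieldType} {m : nat}.
Variables (X : 'I_m.+1 -> normedModType F) (D : forall i, bop (X i) (X i)).
Variable coker : forall i, bop (X i) (X i) -> submodClosed (X i).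
Implicit Type k : 'I_m.

(* [coker T] is the complement K(T) of the closure of the range of [T]; it is
   unconstrained when no complement exists. *)
Definition complement_choice : Prop := forall i (T : bop (X i) (X i)),
  complemented (closure (range T)) ->
  topological_complement (closure (range T)) (coker T).

(* There are n = m + 1 spaces X_1, ..., X_n, indexed by 'I_m.+1; [k : 'I_m]
   stands for k + 1 in 1, ..., n - 1. *)
Definition this_idx k : 'I_m.+1 := widen_ord (leqnSn m) k.
Definition next_idx k : 'I_m.+1 := lift ord0 k.

Definition Delta' k : set F := [set l |
  ~ preceq (subspace_of (coker (sub_scalar (D (this_idx k)) l)))
           (subspace_of (kernel (sub_scalar (D (next_idx k)) l)))].

Definition Delta'' : set F := [set l | ~ regular (sub_scalar (D ord0) l)].

Definition Delta k : set F := [set l |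
  prec (direct_sum (fun s : {s : 'I_m.+1 | (k < s)%N} =>
          subspace_of (kernel (sub_scalar (D (val s)) l))))
       (subspace_of (coker (sub_scalar (D (this_idx k)) l)))].

End DeltaSets.

(* Main.v *)
Require Import Defs.
From HB Require Import structures.
From mathcomp Require Import all_boot all_order all_algebra.
From mathcomp Require Import generic_quotient ring_quotient sesquilinear.
From mathcomp Require Import complex ring lra zify.
From mathcomp Require Import all_classical all_reals topology normedtype.

(** Fix l and write E_i = D_i - l.

    Constructing A: let G_i be a reflexive generalized inverse of E_i, let Q_i
    be the projection onto K(E_i) along R(E_i), and let the embedding
    T_i : K(E_i) -> N(E_(i+1)) have the left inverse S_i.  With
    A_(i,i+1) = S_i (1 - G_(i+1) E_(i+1)) and the other entries zero,
    x_i = G_i (y_i - Q_i y_i) + T_(i-1) Q_(i-1) y_(i-1) solves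
    (T(A) - l) x = y.  The projections Q_i are bounded by Baire's argument.

    Obstruction: if T(A) - l is right invertible, so is its last entry E_n, and
    with N' the kernel of the block of T(A) - l with indices > k, the map
    x |-> Q_k (sum_(j>k) A_(k,j) x_j) sends N' onto K(E_k).  As the E_s with
    s > k are regular, x |-> ((1 - G_s E_s) x_s)_s is an injection of N' into
    the direct sum of the N(E_s).  Between Hilbert spaces an injection
    J : H1 -> H2 yields a surjection H2 -> H1, the adjoint of the isometry in
    the polar decomposition of J; hence the direct sum maps onto K(E_k), which
    contradicts the relation defining Delta_k. *)

Set Implicit Arguments.
Unset Strict Implicit.
Unset Printing Implicit Defensive.

Import Order.TTheory GRing.Theory Num.Theory.
Import numFieldNormedType.Exports.
Local Open Scope classical_set_scope.
Local Open Scope ring_scope.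
Local Open Scope complex_scope.

(** * Equations of abelian groups *)

Inductive zexp := ZVar of nat | ZZero | ZAdd of zexp & zexp | ZOpp of zexp.

Fixpoint zeval (V : zmodType) (env : seq V) (e : zexp) : V :=
  match e with
  | ZVar i => env`_i
  | ZZero => 0
  | ZAdd e1 e2 => zeval env e1 + zeval env e2
  | ZOpp e1 => - zeval env e1
  end.

Fixpoint zcoef (e : zexp) (i : nat) : int :=
  match e with
  | ZVar j => (j == i)%:Z
  | ZZero => 0
  | ZAdd e1 e2 => zcoef e1 i + zcoef e2 i
  | ZOpp e1 => - zcoef e1 i
  end.

Lemma zevalE (V : zmodType) (env : seq V) e :
  zeval env e = \sum_(i < size env) env`_i *~ zcoef e i.
Proof.
elim: e => [j||e1 IH1 e2 IH2|e IH] /=.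
- have [jn|nj] := ltnP j (size env).
    rewrite (bigD1 (Ordinal jn)) //= eqxx big1 ?addr0 // => i.
    by rewrite -val_eqE /= eq_sym => /negPf ->.
  by rewrite nth_default // big1 // => i _; rewrite gtn_eqF // (leq_trans _ nj).
- by rewrite big1.
- by rewrite IH1 IH2 -big_split; apply: eq_bigr => i _; rewrite mulrzDr.
- by rewrite IH -sumrN; apply: eq_bigr => i _; rewrite mulrNz.
Qed.

(** Both sides are integer combinations of the atoms. The test on coefficients is a closed
    computation, which is why [zmod] can discharge it with [isT]. *)
Lemma zeval_eq (V : zmodType) (env : seq V) e1 e2 :
  all (fun i => zcoef e1 i == zcoef e2 i) (iota 0 (size env)) ->
  zeval env e1 = zeval env e2.
Proof.
move=> /allP e12; rewrite !zevalE; apply: eq_bigr => i _.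
by rewrite (eqP (e12 i _)) // mem_iota ltn_ord.
Qed.

(* Equal atoms [a *: v] may carry syntactically different module structures. *)
Ltac zmod_index x env :=
  match env with
  | x :: _ => constr:(0%N)
  | @GRing.scale _ _ ?a ?v :: _ =>
      lazymatch x with @GRing.scale _ _ a v => constr:(0%N) end
  | _ :: ?env' => let n := zmod_index x env' in constr:(S n)
  end.

Ltac zmod_env t env :=
  lazymatch t with
  | @GRing.add _ ?a ?b => let env' := zmod_env a env in zmod_env b env'
  | @GRing.opp _ ?a => zmod_env a env
  | @GRing.zero _ => env
  | ?x => match env with
          (* The index search fails exactly on a new atom, and the match then falls through to the
             branch that adds it. *)
          | _ => let _ := zmod_index x env in env
          | _ => constr:(x :: env)
          end
  end.

Ltac zmod_reify t env :=
  lazymatch t with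
  | @GRing.add _ ?a ?b =>
      let a' := zmod_reify a env in let b' := zmod_reify b env in
      constr:(ZAdd a' b')
  | @GRing.opp _ ?a => let a' := zmod_reify a env in constr:(ZOpp a')
  | @GRing.zero _ => constr:(ZZero)
  | ?x => let n := zmod_index x env in constr:(ZVar n)
  end.

Ltac zmod :=
  lazymatch goal with
  | |- @eq ?T ?a ?b =>
      let env := zmod_env a (@nil T) in
      let env := zmod_env b env in
      let a' := zmod_reify a env in let b' := zmod_reify b env in
      exact: (@zeval_eq _ env a' b' isT)
  end.

(** * Complementary closed subspaces *)

Section RealNorms.
Variable R : realType.

Definition cabs (l : R[i]) : R := complex.Re `|l|.

Lemma cabsE (l : R[i]) : `|l| = (cabs l)%:C.
Proof. by rewrite /cabs normc_def. Qed.

Lemma cabs_ge0 (l : R[i]) : 0 <= cabs l.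
Proof. by rewrite -ler0c -cabsE. Qed.

Lemma cabsR (t : R) : cabs t%:C = `|t|.
Proof. by rewrite /cabs normc_def /= expr0n /= addr0 sqrtr_sqr. Qed.

(** A norm is a plain real-valued function on a bare module, because one space will carry both its
    given norm and an equivalent Hilbert norm. Nonnegativity follows from the triangle inequality
    for [x] and [- x]. *)
Definition is_norm (V : lmodType R[i]) (N : V -> R) : Prop :=
  [/\ forall x y, N (x + y) <= N x + N y,
      forall l x, N (l *: x) = cabs l * N x &
      forall x, N x = 0 -> x = 0].

Definition lim_to (V : lmodType R[i]) (N : V -> R) (u : nat -> V) (l : V) :=
  forall e, 0 < e -> exists k, forall n, (k <= n)%N -> N (u n - l) < e.

Definition cauchy_sq (V : lmodType R[i]) (N : V -> R) (u : nat -> V) :=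
  forall e, 0 < e -> exists k, forall m n, (k <= m)%N -> (k <= n)%N ->
    N (u m - u n) < e.

Definition seq_complete (V : lmodType R[i]) (N : V -> R) :=
  forall u, cauchy_sq N u -> exists l, lim_to N u l.

Definition subspace (V : lmodType R[i]) (W : set V) :=
  W 0 /\ forall l x y, W x -> W y -> W (l *: x + y).

Definition seq_closed (V : lmodType R[i]) (N : V -> R) (W : set V) :=
  forall u l, (forall n, W (u n)) -> lim_to N u l -> W l.

Section OneNorm.
Variables (V : lmodType R[i]) (N : V -> R).
Hypothesis NP : is_norm N.

Lemma is_normD x y : N (x + y) <= N x + N y. Proof. by case: NP. Qed.
Lemma is_normZ l x : N (l *: x) = cabs l * N x. Proof. by case: NP. Qed.
Lemma is_norm_eq0 x : N x = 0 -> x = 0. Proof. by case: NP => _ _; exact. Qed.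

Lemma is_norm0 : N 0 = 0.
Proof. by rewrite -(scale0r 0) is_normZ -[0]/((0 : R)%:C) cabsR normr0 mul0r. Qed.

Lemma is_normN x : N (- x) = N x.
Proof.
by rewrite -scaleN1r is_normZ /cabs normrN1 mul1r.
Qed.

Lemma is_norm_ge0 x : 0 <= N x.
Proof. by have := is_normD x (- x); rewrite subrr is_norm0 is_normN; lra. Qed.

Lemma is_norm_distC x y : N (x - y) = N (y - x).
Proof. by rewrite -is_normN opprB. Qed.

Lemma is_norm_tri x y z : N (x - z) <= N (x - y) + N (y - z).
Proof. by rewrite -[x - z](subrKA y) is_normD. Qed.

Lemma is_normZR (t : R) x : N (t%:C *: x) = `|t| * N x.
Proof. by rewrite is_normZ cabsR. Qed.

Lemma lim_dist_le u l a c k : lim_to N u l ->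
  (forall n, (k <= n)%N -> N (u n - a) <= c) -> N (l - a) <= c.
Proof.
move=> ul uc; apply/ler_addgt0Pr => e /ul[j ju].
have := is_norm_tri l (u (maxn k j)) a.
have := ju _ (leq_maxr k j); have := uc _ (leq_maxl k j).
by rewrite (is_norm_distC l (u _)); lra.
Qed.

Lemma lim_uniq u l l' : lim_to N u l -> lim_to N u l' -> l = l'.
Proof.
move=> ul ul'; apply/subr0_eq/is_norm_eq0/eqP.
rewrite eq_le is_norm_ge0 andbT; apply/ler_addgt0Pr => e e0; rewrite add0r.
have [k ku] := ul' e e0.
by apply: (lim_dist_le (k := k) ul) => n kn; exact/ltW/ku.
Qed.

Lemma lim_cauchy u l : lim_to N u l -> cauchy_sq N u.
Proof.
move=> ul e e0; have [|k kP] := ul (e / 2); first by rewrite divr_gt0.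
exists k => m n /kP um /kP un.
by have := is_norm_tri (u m) l (u n); rewrite (is_norm_distC l); lra.
Qed.

Lemma lim_ext u v l : u =1 v -> lim_to N u l -> lim_to N v l.
Proof. by move=> uv ul e /ul[k ku]; exists k => n /ku; rewrite uv. Qed.

Lemma lim_cst a : lim_to N (fun=> a) a.
Proof. by move=> e e0; exists 0%N => n _; rewrite subrr is_norm0. Qed.

Lemma lim_lin (a : R[i]) u v l l' : lim_to N u l -> lim_to N v l' ->
  lim_to N (fun n => a *: u n + v n) (a *: l + l').
Proof.
move=> ul vl e e0; have a0 := cabs_ge0 a.
have a1 : 0 < cabs a + 1 by lra.
have [|j ju] := ul (e / (cabs a + 1) / 2); first by rewrite !divr_gt0.
have [|k kv] := vl (e / 2); first by rewrite divr_gt0.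
exists (maxn j k) => n; rewrite geq_max => /andP[/ju jn /kv kn].
rewrite opprD addrACA -scalerBr (le_lt_trans (is_normD _ _)) // is_normZ.
suff : cabs a * N (u n - l) <= e / 2 by lra.
apply: le_trans (_ : (cabs a + 1) * (e / (cabs a + 1) / 2) <= _).
  by rewrite ler_pM ?is_norm_ge0 //; lra.
by rewrite le_eqVlt; apply/orP; left; apply/eqP; field; lra.
Qed.

Lemma limD u v l l' : lim_to N u l -> lim_to N v l' ->
  lim_to N (fun n => u n + v n) (l + l').
Proof.
move=> ul vl; have := lim_lin (1) ul vl; rewrite scale1r.
by apply: lim_ext => n; rewrite scale1r.
Qed.

Lemma limB u v l l' : lim_to N u l -> lim_to N v l' ->
  lim_to N (fun n => u n - v n) (l - l').
Proof.
move=> ul vl; have := lim_lin (-1) vl ul; rewrite scaleN1r addrC.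
by apply: lim_ext => n; rewrite scaleN1r addrC.
Qed.

(** The sequence [a] is nondecreasing and bounded, so its increments tend to zero uniformly and
    majorize those of [u]. This form also covers the square root iteration below, whose scalar
    majorant has no geometric rate. *)
Lemma lim_of_steps (NC : seq_complete N) (u : nat -> V) (a : nat -> R) (A : R) :
  (forall n, N (u n.+1 - u n) <= a n.+1 - a n) -> (forall n, a n <= A) ->
  exists l, lim_to N u l /\ forall n, N (l - u n) <= A - a n.
Proof.
move=> ua aA.
have steps n j : N (u (n + j)%N - u n) <= a (n + j)%N - a n.
  elim: j => [|j IHj]; first by rewrite addn0 !subrr is_norm0.
  by have := is_norm_tri (u (n + j.+1)%N) (u (n + j)%N) (u n);
     have := ua (n + j)%N; rewrite addnS; lra.
have mono n j : a n <= a (n + j)%N.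
  by have := steps n j; have := is_norm_ge0 (u (n + j)%N - u n); lra.
have [l ul] : exists l, lim_to N u l.
  apply: NC => e e0.
  have hs : has_sup (range a).
    by split; [exists (a 0%N), 0%N|exists A => _ [n _ <-]].
  have [_ [k _ <-] ak] := sup_adherent e0 hs.
  have aS n : a n <= sup (range a) by apply: ub_le_sup; [case: hs|exists n].
  suff bnd m n : (k <= m)%N -> (m <= n)%N -> N (u n - u m) < e.
    exists k => m n km kn; have [mn|/ltnW nm] := leqP m n.
      by rewrite is_norm_distC bnd.
    by rewrite bnd.
  move=> /subnKC <- /subnKC <-.
  set p := (k + _)%N; set q := (_ - _)%N.
  by have := steps p q; have := aS (p + q)%N; have := mono k (m - k)%N;
    rewrite -/p; lra.
exists l; split=> // n; apply: (lim_dist_le (k := n) ul) => m /subnKC <-.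
by have := steps n (m - n)%N; have := aA (n + (m - n))%N; lra.
Qed.

Lemma subspaceD (W : set V) x y : subspace W -> W x -> W y -> W (x + y).
Proof. by move=> [_ WL] Wx Wy; rewrite -[x]scale1r; exact: WL. Qed.

Lemma subspaceZ (W : set V) a x : subspace W -> W x -> W (a *: x).
Proof. by move=> [W0 WL] Wx; rewrite -[_ *: _]addr0; exact: WL. Qed.

Lemma subspaceB (W : set V) x y : subspace W -> W x -> W y -> W (x - y).
Proof.
by move=> Ws Wx Wy; rewrite -scaleN1r; apply: subspaceD => //; exact: subspaceZ.
Qed.

End OneNorm.

Lemma lim_map (V W : lmodType R[i]) (N : V -> R) (N' : W -> R)
    (NP : is_norm N) (NP' : is_norm N')
    (T : V -> W) (M : R) (TB : {morph T : x y / x - y})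
    (TM : forall x, N' (T x) <= M * N x) u l :
  lim_to N u l -> lim_to N' (T \o u) (T l).
Proof.
move=> ul e e0; have M1 : 0 < `|M| + 1 by have := normr_ge0 M; lra.
have [|k ku] := ul (e / (`|M| + 1)); first exact: divr_gt0.
exists k => n /ku un; rewrite /= -TB (le_lt_trans (TM _)) //.
apply: le_lt_trans (_ : (`|M| + 1) * N (u n - l) < e); last first.
  by rewrite mulrC -ltr_pdivlMr.
by rewrite ler_wpM2r ?(is_norm_ge0 NP) // (le_trans (ler_norm _)) // lerDl.
Qed.

(** * Boundedness of the projection along a closed complement *)

Section Complements.
Variables (V : lmodType R[i]) (N : V -> R).
Hypotheses (NP : is_norm N) (NC : seq_complete N).
Variables W M : set V.
Hypotheses (Ws : subspace W) (Ms : subspace M).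
Hypotheses (Wc : seq_closed N W) (Mc : seq_closed N M).
Hypothesis WM_total : forall x, exists w m, [/\ W w, M m & x = w + m].
Hypothesis WM_cap : forall x, W x -> M x -> x = 0.

Let A (n : nat) (x : V) := exists w m, [/\ W w, M m, x = w + m & N m <= n%:R].

(* Baire's argument: some [A n] is dense in a ball. *)
Let A_somewhere_dense : exists n x r, 0 < r /\
  forall y, N (y - x) < r -> forall e, 0 < e -> exists2 a, A n a & N (a - y) < e.
Proof.
apply: contrapT => noball.
(* Every ball contains the centre [q.1] of a ball of radius [q.2] that misses [A p.1]. The
   positivity of the radius is a premise inside the existential so that [choice] yields a total
   function. *)
have bad (p : nat * (V * R)) : exists q : V * R, 0 < p.2.2 ->
    [/\ N (q.1 - p.2.1) < p.2.2, 0 < q.2 & forall a, A p.1 a -> q.2 <= N (a - q.1)].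
  case: p => n [x r] /=; have [r0|] := ltP 0 r; last by exists (0, 0).
  apply: contrapT => nq; apply: noball; exists n, x, r; split=> // y yx e e0.
  apply: contrapT => na; apply: nq; exists (y, e) => _; split=> // a Aa /=.
  by rewrite leNgt; apply/negP => aye; apply: na; exists a.
have [f fP] := choice bad.
(* Halving the radii makes the centres converge, with the limit within twice the radius of each
   centre. The quarter then keeps the limit within [q.2 / 2] of [q.1], hence outside every [A n]. *)
pose fix s n : V * R := if n is n'.+1 then
  let q := f (n', s n') in (q.1, Num.min (q.2 / 4) ((s n').2 / 2)) else (0, 1).
have s_gt0 n : 0 < (s n).2.
  elim: n => [|n IHn] //=; have [_ q0 _] := fP (n, s n) IHn.
  by rewrite lt_min !divr_gt0.
have s_step n : N ((s n.+1).1 - (s n).1) <= - 2 * (s n.+1).2 - - 2 * (s n).2.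
  have [+ _ _] := fP (n, s n) (s_gt0 n); rewrite /= => qs.
  have : Num.min ((f (n, s n)).2 / 4) ((s n).2 / 2) <= (s n).2 / 2.
    by rewrite ge_min lexx orbT.
  by lra.
have [|l [_ lP]] := lim_of_steps NP NC s_step (A := 0).
  by move=> n; have := s_gt0 n; lra.
have [w [m [Ww Mm lwm]]] := WM_total l.
(* This [n] exceeds the norm of the [M]-component of the limit, so [l] lies in [A n], which it was
   built to avoid. *)
pose n := (Num.truncn (N m)).+1.
have [_ q0 qA] := fP (n, s n) (s_gt0 n).
have /qA/= : A n l.
  exists w, m; split=> //; apply/ltW.
  exact: truncnS_gt.
have := lP n.+1 => /=.
have : Num.min ((f (n, s n)).2 / 4) ((s n).2 / 2) <= (f (n, s n)).2 / 4.
  by rewrite ge_min lexx.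
by move: q0 => /=; lra.
Qed.

(** If [A n] is dense in the ball of radius [r] at [x], approximate [x + t y] and [x] in [A n],
    subtract and divide by [t]. The difference has an [M]-component of norm at most [2 n]. *)
Let approx : exists2 c, 0 <= c & forall y e, 0 < e ->
  exists w m, [/\ W w, M m, N (y - (w + m)) < e & N m <= c * N y].
Proof.
have [n [x [r [r0 dense]]]] := A_somewhere_dense.
exists (4 * n%:R / r) => [|y e e0]; first by rewrite divr_ge0 ?mulr_ge0 // ltW.
have [y0|y0] := eqVneq (N y) 0.
  exists 0, 0; rewrite (is_norm0 NP) addr0 subr0 y0 mulr0.
  by split=> //; [case: Ws|case: Ms].
have Ny : 0 < N y by rewrite lt_def y0 (is_norm_ge0 NP).
(* The vector [t y] has norm [r / 2], so [x + t y] stays in the ball; dividing [2 n] by [t] gives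
   the constant [4 n / r]. *)
pose t := r / (2 * N y).
have t0 : 0 < t by rewrite divr_gt0 // mulr_gt0.
have et0 : 0 < e * t / 2 by rewrite divr_gt0 // mulr_gt0.
have xt : N (x + t%:C *: y - x) < r.
  rewrite (addrC x) addrK (is_normZR NP) gtr0_norm //.
  by have -> : t * N y = r / 2; [rewrite /t; field|lra].
have xx : N (x - x) < r by rewrite subrr (is_norm0 NP).
have [_ [w1 [m1 [Ww1 Mm1 -> m1n]]] a1] := dense _ xt _ et0.
have [_ [w2 [m2 [Ww2 Mm2 -> m2n]]] a2] := dense _ xx _ et0.
exists (t^-1%:C *: (w1 - w2)), (t^-1%:C *: (m1 - m2)).
have tV0 : 0 < t^-1 by rewrite invr_gt0.
split.
- by apply: subspaceZ => //; apply: subspaceB.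
- by apply: subspaceZ => //; apply: subspaceB.
- have -> : y - (t^-1%:C *: (w1 - w2) + t^-1%:C *: (m1 - m2)) =
      t^-1%:C *: ((x + t%:C *: y - (w1 + m1)) - (x - (w2 + m2))).
    have -> : x + t%:C *: y - (w1 + m1) - (x - (w2 + m2)) =
        t%:C *: y - ((w1 - w2) + (m1 - m2)).
      zmod.
    rewrite [RHS]scalerBr [in RHS]scalerDr scalerA -rmorphM mulVf ?gt_eqF //.
    by rewrite scale1r.
  rewrite (is_normZR NP) gtr0_norm // mulrC ltr_pdivrMr //.
  apply: le_lt_trans (is_normD NP _ _) _; rewrite (is_normN NP).
  move: a1 a2; rewrite (is_norm_distC NP (w1 + m1)).
  by rewrite (is_norm_distC NP (w2 + m2)); lra.
- rewrite (is_normZR NP) gtr0_norm //.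
  have -> : 4 * n%:R / r * N y = t^-1 * (2 * n%:R).
    by rewrite /t; field; rewrite y0 gt_eqF.
  rewrite ler_wpM2l //; first exact: ltW.
  by have := is_normD NP m1 (- m2); rewrite (is_normN NP); lra.
Qed.

(** Apply [approx] repeatedly to the remainder, halving the permitted error each time. The [M]-parts
    sum to some [m'] in [M] of norm at most [c (1 + 1/2 + 1/4 + ...) = 2 c] times that of [x];
    closedness of [W] puts [x - m'] in [W], and uniqueness of the decomposition gives [m = m']. *)
Lemma complement_bound : exists2 c, 0 <= c &
  forall w m, W w -> M m -> N m <= c * N (w + m).
Proof.
have [c c0 cP] := approx; exists (2 * c); first by rewrite mulr_ge0.
move=> w m Ww Mm; set x := w + m.
have [x0|x0] := eqVneq (N x) 0.
  have xw : m = x - w by rewrite addrC addKr.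
  suff -> : m = 0 by rewrite (is_norm0 NP) x0 mulr0.
  apply: WM_cap => //; rewrite xw (is_norm_eq0 NP x0).
  by apply: subspaceB => //; case: Ws.
have Nx : 0 < N x by rewrite lt_def x0 (is_norm_ge0 NP).
pose d k : R := N x / 2 ^+ k.
have d_gt0 k : 0 < d k by rewrite divr_gt0 ?exprn_gt0.
have dS k : d k.+1 = d k / 2.
  by rewrite /d exprSr invfM mulrA.
have stepP (p : nat * V) : exists q : V * V,
    [/\ W q.1, M q.2, N (p.2 - (q.1 + q.2)) < d p.1.+1 & N q.2 <= c * N p.2].
  have [w' [m' wmP]] := cP p.2 (d p.1.+1) (d_gt0 _).
  by exists (w', m').
have [f fP] := choice stepP.
(* The first component is the remainder, the second the accumulated [M]-part; the accumulated
   [W]-part is [x] minus both. *)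
pose fix s n : V * V := if n is n'.+1 then
  let q := f (n', (s n').1) in ((s n').1 - (q.1 + q.2), (s n').2 + q.2)
  else (x, 0).
have s1 n : N (s n).1 <= d n.
  case: n => [|n]; first by rewrite /d expr0 divr1.
  by have [_ _ /ltW + _] := fP (n, (s n).1).
have s2M n : M (s n).2.
  elim: n => [|n IHn] /=; first by case: Ms.
  by apply: subspaceD => //; have [] := fP (n, (s n).1).
have s12 n : W (x - (s n).1 - (s n).2).
  elim: n => [|n IHn] /=; first by rewrite subrr subr0; case: Ws.
  have [Wq _ _ _] := fP (n, (s n).1).
  set q := f _ in Wq *.
  rewrite (_ : _ - _ = x - (s n).1 - (s n).2 + q.1); first exact: subspaceD.
  zmod.
have [n|n|m' [sm' m'P]] :=
    lim_of_steps NP NC (u := fun n => (s n).2)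
      (a := fun n => - (2 * c) * d n) (A := 0).
- have [_ _ _] := fP (n, (s n).1) => /=; rewrite [_ + _ - _]addrC addKr dS => fc.
  apply: le_trans fc _.
  by have : c * N (s n).1 <= c * d n; [rewrite ler_wpM2l|lra].
- by rewrite mulNr oppr_le0 mulr_ge0 //; [rewrite mulr_ge0|exact/ltW].
have Mm' : M m' by apply: Mc sm'.
suff -> : m = m'.
  by have := m'P 0%N; rewrite subr0 /d expr0 divr1; lra.
apply/subr0_eq/WM_cap; last exact: subspaceB.
suff Wxm : W (x - m').
  by rewrite (_ : m - m' = x - m' - w); [exact: subspaceB|rewrite /x; zmod].
apply: Wc s12 _; apply: (limB NP) sm'.
(* The bound [N x / e < k <= n < 2 ^ n] makes the remainder smaller than [e]. *)
move=> e e0; pose k := (Num.truncn (N x / e)).+1.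
exists k => n kn; rewrite addrAC subrr add0r (is_normN NP).
apply: le_lt_trans (s1 n) _; rewrite /d ltr_pdivrMr ?exprn_gt0 //.
rewrite mulrC -ltr_pdivrMr //.
apply: lt_le_trans (truncnS_gt _) _; rewrite -/k.
rewrite -natrX ler_nat (leq_trans kn) //.
by rewrite ltnW // ltn_expl.
Qed.

End Complements.
End RealNorms.

(** * Inner products and the polar decomposition *)

Section LinearMaps.
Variables (F : pzRingType) (V W : lmodType F) (T : V -> W).
Hypothesis Tl : linear T.

Lemma lin_mapD : {morph T : x y / x + y}.
Proof. by move=> x y; have := Tl 1 x y; rewrite !scale1r. Qed.

Lemma lin_mapB : {morph T : x y / x - y}.
Proof. by move=> x y; rewrite addrC -scaleN1r Tl scaleN1r addrC. Qed.

Lemma lin_map0 : T 0 = 0.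
Proof. by have := lin_mapB 0 0; rewrite !subrr. Qed.

Lemma lin_mapN x : T (- x) = - T x.
Proof. by rewrite -sub0r lin_mapB lin_map0 sub0r. Qed.

Lemma lin_mapZ a x : T (a *: x) = a *: T x.
Proof. by have := Tl a x 0; rewrite lin_map0 !addr0. Qed.

End LinearMaps.

Section InnerProducts.
Variable R : realType.

(* The real part of a complex inner product; it determines the latter. *)
Record is_inner (V : lmodType R[i]) (r : V -> V -> R) : Prop := IsInner {
  innerDl : forall x y z, r (x + y) z = r x z + r y z;
  innerZl : forall (t : R) x y, r (t%:C *: x) y = t * r x y;
  innerC : forall x y, r x y = r y x;
  innerJ : forall l x y, r (l *: x) y = r x (l^* *: y);
  inner_ge0 : forall x, 0 <= r x x;
  inner_eq0 : forall x, r x x = 0 -> x = 0 }.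

Definition hnorm (V : lmodType R[i]) (r : V -> V -> R) (x : V) : R :=
  Num.sqrt (r x x).

Section OneInner.
Variables (V : lmodType R[i]) (r : V -> V -> R).
Hypothesis rP : is_inner r.
Local Notation hn := (hnorm r).

Lemma innerDr x y z : r x (y + z) = r x y + r x z.
Proof. by rewrite innerC // innerDl // !(innerC rP _ x). Qed.

Lemma innerZr (t : R) x y : r x (t%:C *: y) = t * r x y.
Proof. by rewrite innerC // innerZl // innerC. Qed.

Lemma innerNl x y : r (- x) y = - r x y.
Proof.
by rewrite -scaleN1r -[-1](rmorphN1 (real_complex R)) innerZl // mulN1r.
Qed.

Lemma innerNr x y : r x (- y) = - r x y.
Proof. by rewrite innerC // innerNl innerC. Qed.

Lemma innerBl x y z : r (x - y) z = r x z - r y z.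
Proof. by rewrite innerDl // innerNl. Qed.

Lemma innerBr x y z : r x (y - z) = r x y - r x z.
Proof. by rewrite innerDr innerNr. Qed.

Lemma inner0l x : r 0 x = 0.
Proof. by rewrite -(subrr 0) innerBl subrr. Qed.

Lemma hnorm_ge0 x : 0 <= hn x. Proof. exact: sqrtr_ge0. Qed.

Lemma hnorm_sq x : hn x ^+ 2 = r x x.
Proof. by rewrite sqr_sqrtr // inner_ge0. Qed.

Lemma hnorm_eq0 x : hn x = 0 -> x = 0.
Proof.
by move=> x0; apply: (inner_eq0 rP); rewrite -hnorm_sq x0 expr0n.
Qed.

(** Cauchy-Schwarz: the square of [|y| x - |x| y] equals [2 |x| |y| (|x| |y| - r x y)], and the
    positive factor cancels once the zero vectors are set aside. *)
Lemma inner_le x y : r x y <= hn x * hn y.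
Proof.
have [/hnorm_eq0 x0|x0] := eqVneq (hn x) 0.
  by rewrite x0 inner0l mulr_ge0 ?hnorm_ge0.
have [/hnorm_eq0 y0|y0] := eqVneq (hn y) 0.
  by rewrite innerC // y0 inner0l mulr_ge0 ?hnorm_ge0.
have xy : 0 < hn x * hn y.
  by rewrite mulr_gt0 // lt_def ?x0 ?y0 hnorm_ge0.
have := inner_ge0 rP ((hn y)%:C *: x - (hn x)%:C *: y).
rewrite !(innerBl, innerBr) !(innerZl rP, innerZr) -!hnorm_sq (innerC rP y).
rewrite [leRHS](_ : _ = 2 * (hn x * hn y * (hn x * hn y - r x y))); last ring.
by rewrite !pmulr_rge0 // subr_ge0.
Qed.

Lemma hnormD_sq x y : hn (x + y) ^+ 2 = hn x ^+ 2 + hn y ^+ 2 + 2 * r x y.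
Proof. by rewrite !hnorm_sq innerDl // !innerDr (innerC rP y x); ring. Qed.

Lemma hnormB_sq x y : hn (x - y) ^+ 2 = hn x ^+ 2 + hn y ^+ 2 - 2 * r x y.
Proof. by rewrite !hnorm_sq innerBl // !innerBr (innerC rP y x); ring. Qed.

Lemma hnorm_is_norm : is_norm hn.
Proof.
split=> [x y|l x|x]; last exact: hnorm_eq0.
- rewrite -ler_sqr ?nnegrE ?addr_ge0 ?hnorm_ge0 // hnormD_sq.
  by have := inner_le x y; rewrite sqrrD; lra.
- apply/eqP; rewrite -(eqrXn2 (n := 2)) ?mulr_ge0 ?cabs_ge0 ?hnorm_ge0 //.
  rewrite exprMn !hnorm_sq innerJ // scalerA.
  rewrite mulrC -normCK cabsE -rmorphXn /=.
  by rewrite innerZr.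
Qed.

Lemma inner_dist_le x y z : `|r x z - r y z| <= hn (x - y) * hn z.
Proof.
rewrite ler_norml -innerBl inner_le andbT lerNl -innerNl.
by rewrite -(is_normN hnorm_is_norm) inner_le.
Qed.

Lemma lim_inner_eq (u v : nat -> V) l l' y y' :
  lim_to hn u l -> lim_to hn v l' -> (forall n, r (u n) y = r (v n) y') ->
  r l y = r l' y'.
Proof.
move=> ul vl uv; apply/subr0_eq/eqP; rewrite -normr_le0; apply/ler_addgt0Pr => e e0.
have c0 : 0 < hn y + hn y' + 1 by have := hnorm_ge0 y; have := hnorm_ge0 y'; lra.
have [|j ju] := ul (e / (hn y + hn y' + 1)); first exact: divr_gt0.
have [|k kv] := vl (e / (hn y + hn y' + 1)); first exact: divr_gt0.
have := ju _ (leq_maxl j k); have := kv _ (leq_maxr j k); set n := maxn j k.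
have := inner_dist_le (u n) l y; have := inner_dist_le (v n) l' y'.
rewrite (uv n) => H1 H2 H3 H4.
have {}H1 : `|r (v n) y' - r l' y'| <= e / (hn y + hn y' + 1) * hn y'.
  by apply: le_trans H1 _; rewrite ler_wpM2r ?hnorm_ge0 // ltW.
have {}H2 : `|r (v n) y' - r l y| <= e / (hn y + hn y' + 1) * hn y.
  by apply: le_trans H2 _; rewrite ler_wpM2r ?hnorm_ge0 // ltW.
have := ler_distD (r (v n) y') (r l y) (r l' y').
rewrite add0r (distrC (r l y) (r (v n) y')) => H; apply: le_trans H _.
apply: le_trans (lerD H2 H1) _; rewrite -mulrDr -mulrA ler_piMr ?ltW //.
by rewrite mulrC ltr_pdivrMr // mul1r; lra.
Qed.

Lemma innerJr l x y : r x (l *: y) = r (l^* *: x) y.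
Proof. by rewrite innerJ // conjCK. Qed.

Lemma inner_ext u v : (forall x, r x u = r x v) -> u = v.
Proof.
move=> uv; apply/subr0_eq/(inner_eq0 rP).
by rewrite innerBr uv subrr.
Qed.

End OneInner.

(** * The Riesz representation theorem *)

Section Riesz.
Variables (V H : lmodType R[i]) (r : H -> H -> R).
Local Notation hn := (hnorm r).

(* Minimising [|B x|^2 - 2 psi x]: the values [B x] of a minimising sequence
   converge.  For [B = id] this is the Riesz representation theorem; other
   choices of [B] replace orthogonal projections and extensions by density. *)
Lemma riesz (rP : is_inner r)
    (HC : seq_complete hn) (B : V -> H) (Bl : linear B)
    (psi : V -> R) (M : R) :
  (forall x y, psi (x + y) = psi x + psi y) ->
  (forall (t : R) x, psi (t%:C *: x) = t * psi x) ->
  0 <= M -> (forall x, psi x <= M * hn (B x)) ->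
  exists z, [/\ forall x, psi x = r (B x) z, hn z <= M &
                exists u, lim_to hn (B \o u) z].
Proof.
move=> psiD psiZ M0 psiM.
have NP := hnorm_is_norm rP.
have hn0 x : 0 <= hn x := hnorm_ge0 r x.
pose f x := hn (B x) ^+ 2 - 2 * psi x.
have fM x : - M ^+ 2 <= f x.
  by rewrite /f; have := psiM x; have := sqr_ge0 (M - hn (B x)); nra.
have hi : has_inf (range f).
  by split; [exists (f 0), 0|exists (- M ^+ 2) => _ [x _ <-]].
pose I := inf (range f).
have If x : I <= f x by apply: ge_inf; [case: hi|exists x].
have near_inf n : exists x, f x < I + n.+1%:R^-1.
  have n0 : 0 < n.+1%:R^-1 :> R by rewrite invr_gt0.
  by have [_ [x _ <-] fx] := inf_adherent n0 hi; exists x.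
have [u uP] := choice near_inf.
(* Parallelogram law, with [f] bounded below by [I] at the midpoint of [x] and [y]. *)
have par x y : hn (B x - B y) ^+ 2 <= 2 * (f x + f y - 2 * I).
  have := If ((2^-1)%:C *: (x + y)); rewrite /f psiZ psiD (lin_mapZ Bl).
  rewrite (lin_mapD Bl) (is_normZR NP) exprMn (hnormB_sq rP) (hnormD_sq rP).
  by rewrite ger0_norm //; lra.
have [z uz] : exists z, lim_to hn (B \o u) z.
  apply: HC => e e0; pose k := Num.truncn (4 / e ^+ 2).
  have kP : k.+1%:R^-1 < e ^+ 2 / 4.
    rewrite -[e ^+ 2 / 4]invrK ltf_pV2 ?posrE ?invr_gt0 ?divr_gt0 ?exprn_gt0 //.
    by rewrite invf_div truncnS_gt.
  have mk n : (k <= n)%N -> n.+1%:R^-1 <= k.+1%:R^-1 :> R.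
    by move=> kn; rewrite lef_pV2 ?posrE // ler_nat.
  exists k => m n /mk km /mk kn.
  rewrite -ltr_sqr ?nnegrE ?hn0 ?ltW //; apply: le_lt_trans (par _ _) _.
  move: (uP m) (uP n) km kn kP.
  by move: (m.+1%:R^-1) (n.+1%:R^-1) (k.+1%:R^-1) => p q s; lra.
exists z.
have rz x : psi x = r (B x) z.
  pose d := r (B x) z - psi x.
  (* First variation in the direction [x]. The infimum need not be attained, so it is taken along
     the minimising sequence: [I <= f (u n + t x)] while [f (u n)] tends to [I]. *)
  have var t : 0 <= t ^+ 2 * hn (B x) ^+ 2 + 2 * (t * d).
    apply/ler_addgt0Pr => e e0.
    have c0 : 0 < 4 * (`|t| * hn (B x) + 1).
      by have := mulr_ge0 (normr_ge0 t) (hn0 (B x)); lra.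
    have [|k ku] := uz (e / (4 * (`|t| * hn (B x) + 1))); first exact: divr_gt0.
    pose n := maxn k (Num.truncn (2 / e)).
    have ne : n.+1%:R^-1 < e / 2.
      rewrite -[e / 2]invrK ltf_pV2 ?posrE ?invr_gt0 ?divr_gt0 //.
      rewrite invf_div (lt_le_trans (truncnS_gt _)) // ler_nat ltnS.
      exact: leq_maxr.
    have := inner_dist_le rP (B (u n)) z (B x).
    have := ku n (leq_maxl _ _); rewrite /=.
    set q := hn (_ - z) => qe rq.
    have : `|t| * `|r (B (u n)) (B x) - r z (B x)| <= e / 4.
      apply: le_trans (_ : `|t| * (q * hn (B x)) <= _); first by rewrite ler_wpM2l.
      have -> : e / 4 = e / (4 * (`|t| * hn (B x) + 1)) * (`|t| * hn (B x) + 1).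
        by field; lra.
      rewrite mulrCA ler_pM ?mulr_ge0 ?hn0 //; first exact: ltW.
      by lra.
    rewrite -normrM => /(le_trans (ler_norm _)).
    rewrite !(innerC rP _ (B x)) mulrBr => tq.
    have := If (u n + t%:C *: x); rewrite /f psiD psiZ (lin_mapD Bl) (lin_mapZ Bl).
    rewrite (hnormD_sq rP) (is_normZR NP) exprMn real_normK ?num_real //.
    rewrite (innerZr rP) (innerC rP (B (u n))).
    move: (uP n) ne; rewrite /f /d mulrBr.
    by move: (n.+1%:R^-1) => p; lra.
  (* A near-optimal [t] whose denominator is positive even if [B x = 0]; it turns [var] into an
     inequality that forces [d = 0]. *)
  have := var (- (d / (hn (B x) ^+ 2 + 1))).
  set b := hn (B x) ^+ 2; have b0 : 0 <= b by rewrite sqr_ge0.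
  have -> : (- (d / (b + 1))) ^+ 2 * b + 2 * (- (d / (b + 1)) * d) =
      - ((d / (b + 1)) ^+ 2 * (b + 2)) by field; lra.
  rewrite oppr_ge0 => db.
  have : (d / (b + 1)) ^+ 2 * (b + 2) == 0.
    by rewrite eq_le db mulr_ge0 ?sqr_ge0; lra.
  rewrite mulf_eq0 sqrf_eq0 mulf_eq0 invr_eq0 => /orP[/orP[/eqP|/eqP]|/eqP]; try lra.
  by rewrite /d; lra.
split=> //; last by exists u.
(* As [z] is only a limit of values of [B], the bound comes from [|z|^2 = lim psi (u k)] and
   [psi (u k) <= M |B (u k)|]. *)
have [->|z0] := eqVneq (hn z) 0; first by [].
have {}z0 : 0 < hn z by rewrite lt_def z0 hn0.
suff : hn z * hn z <= M * hn z by rewrite ler_pM2r.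
apply/ler_addgt0Pr => e e0.
have c0 : 0 < M + hn z by lra.
have [|k ku] := uz (e / (M + hn z)); first exact: divr_gt0.
have := ku k (leqnn k); rewrite /=; set q := hn (_ - z) => qe.
have qe' : q * (M + hn z) < e by rewrite -ltr_pdivlMr.
have := inner_dist_le rP (B (u k)) z z; rewrite ler_norml => /andP[+ _].
rewrite -rz -(hnorm_sq rP) -/q => H1.
have := psiM (u k) => H2.
have : hn (B (u k)) <= hn z + q.
  by have := is_normD NP (B (u k) - z) z; rewrite subrK -/q; lra.
have := hn0 (B (u k)); have := hn0 (B (u k) - z); rewrite -/q.
by nra.
Qed.

End Riesz.

(** * Square root of 1 - C for a symmetric contraction C *)

Section SquareRoot.
Variables (V : lmodType R[i]) (r : V -> V -> R).
Hypotheses (rP : is_inner r) (VC : seq_complete (hnorm r)).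
Local Notation hn := (hnorm r).
Variable C : V -> V.
Hypotheses (Cl : linear C) (C1 : forall x, hn (C x) <= hn x).
Hypothesis Csym : forall x y, r (C x) y = r x (C y).

(* [Y n] converges to [1 - sqrt (1 - C)]. *)
Let Y := fix Y n (x : V) : V :=
  if n is n'.+1 then (2^-1)%:C *: (C x + Y n' (Y n' x)) else 0.

(* The same iteration for the scalar [1] in place of [C]. *)
Let a := fix a n : R := if n is n'.+1 then (1 + a n' ^+ 2) / 2 else 0.

Let a_bnd n : 0 <= a n <= 1.
Proof.
elim: n => [|n /andP[a0 a1]] /=; first by rewrite lexx ler01.
by apply/andP; split; nra.
Qed.

Let Yl n : linear (Y n).
Proof.
elim: n => [|n IHn] l x y /=; first by rewrite scaler0 addr0.
rewrite !IHn Cl addrACA -[l *: _ + l *: _]scalerDr [LHS]scalerDr !scalerA.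
by rewrite mulrC.
Qed.

Let Ysym n x y : r (Y n x) y = r x (Y n y).
Proof.
elim: n x y => [|n IHn] x y /=; first by rewrite inner0l // innerC // inner0l.
by rewrite innerZl // innerZr // innerDl // innerDr // Csym !IHn.
Qed.

Let NP := hnorm_is_norm rP.

Let Y_bnd n x : hn (Y n x) <= a n * hn x.
Proof.
elim: n x => [|n IHn] x /=; first by rewrite mul0r (is_norm0 NP).
rewrite (is_normZR NP) ger0_norm ?invr_ge0 //.
have := is_normD NP (C x) (Y n (Y n x)); have := C1 x; have := IHn (Y n x).
have /andP[a0 _] := a_bnd n; have := ler_wpM2l a0 (IHn x).
by rewrite expr2; lra.
Qed.

(** Induction on the factorisation [P^2 - Q^2 = P (P - Q) + (P - Q) Q], valid without commutation,
    for [P = Y n.+1] and [Q = Y n]. The scalars satisfy the same recursion, so each bound is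
    mirrored by the increment of [a]. *)
Let Y_step n x : hn (Y n.+1 x - Y n x) <= a n.+1 * hn x - a n * hn x.
Proof.
rewrite -mulrBl; elim: n x => [|n IHn] x.
  rewrite /= subr0 addr0 (is_normZR NP) ger0_norm ?invr_ge0 //.
  by have := C1 x; rewrite expr0n /=; lra.
have -> : Y n.+2 x - Y n.+1 x = (2^-1)%:C *:
    (Y n.+1 (Y n.+1 x - Y n x) + (Y n.+1 (Y n x) - Y n (Y n x))).
  rewrite (lin_mapB (Yl _)) addrA subrK.
  rewrite -[Y n.+2 x]/((2^-1)%:C *: (C x + Y n.+1 (Y n.+1 x))).
  rewrite -[X in _ - X = _]/((2^-1)%:C *: (C x + Y n (Y n x))) -scalerBr.
  by congr (_ *: _); zmod.
rewrite (is_normZR NP) ger0_norm ?invr_ge0 //.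
have := is_normD NP (Y n.+1 (Y n.+1 x - Y n x)) (Y n.+1 (Y n x) - Y n (Y n x)).
have := Y_bnd n.+1 (Y n.+1 x - Y n x); have := IHn (Y n x).
have /andP[a0 _] := a_bnd n.+1; have := ler_wpM2l a0 (IHn x).
have a01 : 0 <= a n.+1 - a n by have := sqr_ge0 (a n - 1); rewrite /=; nra.
have := ler_wpM2l a01 (Y_bnd n x).
have -> : a n.+2 - a n.+1 = (a n.+1 ^+ 2 - a n ^+ 2) / 2 by rewrite /=; field.
by move: (a n.+1) (a n) => b c; lra.
Qed.

(** The last equation says [(1 - Z)^2 = 1 - C]. The limit exists pointwise because the steps of [Y]
    are dominated by those of the bounded sequence [a]. *)
Lemma sqrt_step : exists Z : V -> V, [/\ linear Z,
  forall x y, r (Z x) y = r x (Z y) & forall x, Z x + Z x = C x + Z (Z x)].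
Proof.
have limY x : exists l, lim_to hn (Y ^~ x) l.
  have [|n|l [Yx _]] := lim_of_steps NP VC (u := Y ^~ x)
    (a := fun n => a n * hn x) (A := hn x).
  - by move=> n; apply: Y_step.
  - by rewrite ler_piMl ?hnorm_ge0 //; have /andP[] := a_bnd n.
  - by exists l.
have [Z ZP] := choice limY.
exists Z; split=> [l x y|x y|x].
- apply: (lim_uniq NP (ZP _)); apply: lim_ext (lim_lin NP l (ZP x) (ZP y)).
  by move=> n /=; rewrite Yl.
- rewrite (innerC rP x); apply: (lim_inner_eq rP (ZP x) (ZP y)) => n.
  by rewrite Ysym innerC.
(* Pointwise convergence passes to the square since all [Y n] are contractions. *)
have YY : lim_to hn (fun n => Y n (Y n x)) (Z (Z x)).
  move=> e e0; have e2 : 0 < e / 2 by lra.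
  have [j jP] := ZP x _ e2; have [k kP] := ZP (Z x) _ e2.
  exists (maxn j k) => n; rewrite geq_max => /andP[/jP jn /kP kn].
  rewrite (_ : _ - _ = Y n (Y n x - Z x) + (Y n (Z x) - Z (Z x))); last first.
    by rewrite (lin_mapB (Yl n)); zmod.
  apply: le_lt_trans (is_normD NP _ _) _.
  have := Y_bnd n (Y n x - Z x); have /andP[_ a1] := a_bnd n.
  have := ler_wpM2r (hnorm_ge0 r (Y n x - Z x)) a1; lra.
apply: (lim_uniq NP) (limD NP (lim_cst NP (C x)) YY).
have ZS : lim_to hn (fun n => Y n.+1 x) (Z x).
  by move=> e /(ZP x)[k kP]; exists k => n kn; apply: kP; rewrite leqW.
apply: lim_ext (limD NP ZS ZS) => n /=.
by rewrite -scalerDl -rmorphD (_ : 2^-1 + 2^-1 = 1 :> R) ?scale1r //; field.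
Qed.

End SquareRoot.

(* The adjoint of the isometry in the polar decomposition [J = U^* sqrt (J^* J)]
   is defined directly, by [r1 (sqrt (J^* J) x) (U y) = r2 (J x) y]. *)
Lemma surjection_of_contraction (V1 V2 : lmodType R[i])
    (r1 : V1 -> V1 -> R) (r2 : V2 -> V2 -> R)
    (r1P : is_inner r1) (r2P : is_inner r2)
    (V1C : seq_complete (hnorm r1)) (V2C : seq_complete (hnorm r2))
    (J : V1 -> V2) (Jl : linear J) (J1 : forall x, hnorm r2 (J x) <= hnorm r1 x)
    (J_inj : forall x, J x = 0 -> x = 0) :
  exists U : V2 -> V1, [/\ linear U, forall y, hnorm r1 (U y) <= hnorm r2 y &
    forall x, exists y, U y = x].
Proof.
have N1 := hnorm_is_norm r1P; have N2 := hnorm_is_norm r2P.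
have psiD y x x' : r2 (J (x + x')) y = r2 (J x) y + r2 (J x') y.
  by rewrite (lin_mapD Jl) innerDl.
have psiZ y (t : R) x : r2 (J (t%:C *: x)) y = t * r2 (J x) y.
  by rewrite (lin_mapZ Jl) innerZl.
(* The adjoint [Ja] of [J], by [riesz] with the identity for [B]. *)
have adj y : exists z,
    (forall x, r2 (J x) y = r1 x z) /\ hnorm r1 z <= hnorm r2 y.
  have idl : linear (id : V1 -> V1) by [].
  have [|z [zP zy _]] := riesz r1P V1C idl (psiD y) (psiZ y) (hnorm_ge0 r2 y).
    move=> x; apply: le_trans (inner_le r2P _ _) _.
    by rewrite mulrC ler_wpM2l ?hnorm_ge0.
  by exists z.
have [Ja JaP] := choice adj.
have {JaP} [JaE Ja1] : (forall y x, r2 (J x) y = r1 x (Ja y)) /\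
    forall y, hnorm r1 (Ja y) <= hnorm r2 y.
  by split=> y; have [] := JaP y.
have Jal : linear Ja.
  move=> l y y'; apply: (inner_ext r1P) => x.
  rewrite (innerDr r1P) (innerJr r1P) -!JaE (innerDr r2P) (innerJr r2P).
  by rewrite (lin_mapZ Jl).
pose C x := x - Ja (J x).
have Cl : linear C.
  by move=> l x y; rewrite /C Jl Jal scalerBr; zmod.
have Csym x y : r1 (C x) y = r1 x (C y).
  by rewrite (innerBl r1P) (innerBr r1P) (innerC r1P (Ja _) y) -!JaE (innerC r2P).
(* With [C = 1 - J^* J], the square of [|C x|] is [|x|^2 - 2 |J x|^2 + |J^* J x|^2], and the last
   term is at most [|J x|^2]. *)
have C1 x : hnorm r1 (C x) <= hnorm r1 x.
  rewrite -ler_sqr ?nnegrE ?hnorm_ge0 // (hnormB_sq r1P) -JaE -(hnorm_sq r2P).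
  have : hnorm r1 (Ja (J x)) ^+ 2 <= hnorm r2 (J x) ^+ 2.
    by rewrite ler_sqr ?nnegrE ?hnorm_ge0 // Ja1.
  by have := sqr_ge0 (hnorm r2 (J x)); lra.
have [Z [Zl Zsym ZE]] := sqrt_step r1P V1C Cl C1 Csym.
(* A symmetric square root of [J^* J]; hence [B] and [J] have the same norms and the same kernel. *)
pose B x := x - Z x.
have Bl : linear B.
  by move=> l x y; rewrite /B Zl scalerBr; zmod.
have Bsym x y : r1 (B x) y = r1 x (B y).
  by rewrite (innerBl r1P) (innerBr r1P) Zsym.
have BB x : B (B x) = Ja (J x).
  rewrite /B (lin_mapB Zl).
  have -> : x - Z x - (Z x - Z (Z x)) = x - (Z x + Z x) + Z (Z x) by zmod.
  by rewrite ZE /C; zmod.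
have BJ x y : r1 (B x) (B y) = r2 (J x) (J y) by rewrite Bsym BB JaE.
have hBJ x : hnorm r1 (B x) = hnorm r2 (J x) by rewrite /hnorm BJ.
(* The range of [B] is dense: a vector orthogonal to it is killed by the symmetric [B], hence by the
   injective [J]. *)
have B_ext z z' : (forall x, r1 (B x) z = r1 (B x) z') -> z = z'.
  move=> zz'; apply/subr0_eq/J_inj/(is_norm_eq0 N2); rewrite -hBJ.
  rewrite (_ : B (z - z') = 0) ?(is_norm0 N1) //.
  apply: (inner_ext r1P) => x.
  by rewrite -Bsym (innerBr r1P) zz' subrr innerC // inner0l.
(* The functional [r2 (J x) y] is bounded by [|y| |B x|], so [riesz] applies with this [B]. *)
have coiso y : exists z,
    (forall x, r2 (J x) y = r1 (B x) z) /\ hnorm r1 z <= hnorm r2 y.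
  have [|z [zP zy _]] := riesz r1P V1C Bl (psiD y) (psiZ y) (hnorm_ge0 r2 y).
    by move=> x; rewrite hBJ mulrC; exact: inner_le.
  by exists z.
have [U UP] := choice coiso.
have {UP} [UE U1] : (forall y x, r2 (J x) y = r1 (B x) (U y)) /\
    forall y, hnorm r1 (U y) <= hnorm r2 y.
  by split=> y; have [] := UP y.
have Ul : linear U.
  move=> l y y'; apply: B_ext => x.
  rewrite (innerDr r1P) (innerJr r1P) -(lin_mapZ Bl) -!UE.
  by rewrite (innerDr r2P) (innerJr r2P) (lin_mapZ Jl).
have UJ x : U (J x) = B x by apply: B_ext => x'; rewrite BJ UE.
exists U; split=> // h.
(* Here [riesz] serves to write [h] as a limit of [B (u n)]. Then [J (u n)] is Cauchy because [B]
   and [J] have equal norms, and its limit is a preimage of [h] since [U J = B]. *)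
have [||||z [zP _ [u uz]]] :=
    riesz r1P V1C Bl (psi := fun x => r1 (B x) h) (M := hnorm r1 h).
- by move=> x y; rewrite (lin_mapD Bl) innerDl.
- by move=> t x; rewrite (lin_mapZ Bl) innerZl.
- exact: hnorm_ge0.
- by move=> x; rewrite mulrC; exact: inner_le.
have zh : z = h by apply: B_ext => x; rewrite -zP.
rewrite zh in uz.
have Ju : cauchy_sq (hnorm r2) (J \o u).
  move=> e /(lim_cauchy N1 uz)[k kP]; exists k => m n km kn.
  by rewrite /= -(lin_mapB Jl) -hBJ (lin_mapB Bl) kP.
have [y Juy] := V2C _ Ju; exists y.
have UM x : hnorm r1 (U x) <= 1 * hnorm r2 x by rewrite mul1r.
apply: (lim_uniq N1) uz.
by apply: lim_ext (lim_map N2 N1 (lin_mapB Ul) UM Juy) => n /=; rewrite UJ.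
Qed.

End InnerProducts.

(** * Bounded operators *)

Lemma dep_choice (I : Type) (T : I -> Type) (P : forall i, T i -> Prop) :
  (forall i, exists x, P i x) -> exists f : forall i, T i, forall i, P i (f i).
Proof.
by move=> PT; exists (fun i => projT1 (cid (PT i))) => i; case: (cid (PT i)).
Qed.

Section RealNorm.
Variable R : realType.
Implicit Types X Y Z : normedModType R[i].

(** The given norm takes values in [R[i]]; its real part makes the order and completeness of [R]
    available. *)
Definition nr X (x : X) : R := complex.Re `|x|.

Lemma nrE X (x : X) : `|x| = (nr x)%:C.
Proof.
by have := ger0_Im (normr_ge0 x); rewrite /nr; case: `|x| => a b /= ->.
Qed.

Lemma nr_is_norm X : is_norm (@nr X).
Proof.
split=> [x y|l x|x x0].
- by rewrite -lecR rmorphD /= -!nrE ler_normD.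
- by apply: complexI; rewrite -nrE normrZ rmorphM /= -nrE cabsE.
- by apply/normr0_eq0; rewrite nrE x0.
Qed.

Definition nr_bounded X Y (T : X -> Y) :=
  exists2 M, 0 <= M & forall x, nr (T x) <= M * nr x.

(** The bound in [op_bounded] is a complex scalar. Its modulus serves as well, because a scalar
    dominating a norm is nonnegative and so equals its own modulus. *)
Lemma bop_bounded X Y (T : bop X Y) : nr_bounded T.
Proof.
have [l Tl] := bopP T; exists (cabs l) => [|x]; first exact: cabs_ge0.
rewrite -lecR rmorphM /= -!nrE -cabsE.
have H := Tl x; apply: le_trans H _.
have -> : `|l| * `|x| = `| l * `|x| | by rewrite normrM normr_id.
apply: real_ler_norm; apply: ger0_real.
exact: le_trans (normr_ge0 _) (Tl x).
Qed.

Lemma bop_linear X Y (T : bop X Y) : linear T.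
Proof. by move=> a x y; rewrite linearP. Qed.

Lemma bop_of X Y (T : X -> Y) : linear T -> nr_bounded T ->
  exists S : bop X Y, forall x, S x = T x.
Proof.
move=> Tl [M M0 TM].
pose T' : {linear X -> Y} := HB.pack T (GRing.isLinear.Build _ _ _ _ T Tl).
have T'b : op_bounded T'.
  by exists M%:C => x; rewrite !nrE -rmorphM lecR; exact: TM.
by exists (Bop T'b).
Qed.

Lemma lim_nr_map X Y (T : X -> Y) : linear T -> nr_bounded T -> forall u l,
  lim_to (@nr X) u l -> lim_to (@nr Y) (T \o u) (T l).
Proof.
move=> Tl [M _ TM] u l.
exact: (lim_map (nr_is_norm X) (nr_is_norm Y) (lin_mapB Tl) TM).
Qed.

Lemma nr_complete (X : completeNormedModType R[i]) : seq_complete (@nr X).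
Proof.
move=> u uC.
have gt0E (e : R[i]) : 0 < e -> e = (complex.Re e)%:C /\ 0 < complex.Re e.
  by case: e => a b; rewrite ltcE /= => /andP[/eqP -> ?].
have : cvg (u @ \oo).
  suff : cauchy (u @ \oo) by exact: cauchy_cvg.
  suff : cauchy_ex (u @ \oo) by exact: cauchy_exP.
  move=> e /gt0E[-> e0].
  have [k kP] := uC _ e0; exists (u k); exists k => // n /= kn.
  by rewrite -ball_normE /ball_ /= nrE ltcR kP /=.
move=> /cvg_ex[l /cvgrPdist_lt ul]; exists l => e e0.
have [|k _ kP] := ul e%:C; first by rewrite ltcR.
exists k => n /kP; rewrite /= nrE ltcR (is_norm_distC (nr_is_norm X)).
exact.
Qed.

Lemma closureP X (A : set X) x :
  closure A x <-> forall e, 0 < e -> exists2 a, A a & nr (a - x) < e.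
Proof.
split=> [Ax e e0|Ax B /nbhs_ballP[e /= e0 eB]].
  have [|a [Aa]] := Ax (ball x e%:C); first by apply: nbhsx_ballx; rewrite ltcR.
  rewrite -ball_normE /ball_ /= nrE ltcR (is_norm_distC (nr_is_norm X)).
  by exists a.
have [|a Aa ax] := Ax (complex.Re e).
  by move: e0; case: e {eB} => a b; rewrite ltcE => /andP[].
exists a; split=> //; apply: eB; rewrite -ball_normE /ball_ /= nrE.
rewrite (is_norm_distC (nr_is_norm X)).
move: e0 ax; case: e => b c; rewrite !ltcE /= => /andP[/eqP -> _] ->.
by rewrite eqxx.
Qed.

Lemma closed_seq_closed X (A : set X) : closed A -> seq_closed (@nr X) A.
Proof.
move=> Ac u l uA ul; apply: Ac; apply/closureP => e /ul[k kP].
by exists (u k) => //; exact: kP.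
Qed.

Lemma closure_seq X (A : set X) x : closure A x ->
  exists u, (forall n, A (u n)) /\ lim_to (@nr X) u x.
Proof.
move=> /closureP Ax.
have near n : exists a, A a /\ nr (a - x) < n.+1%:R^-1.
  by have [|a] := Ax n.+1%:R^-1; [rewrite invr_gt0|exists a].
have [u uP] := choice near.
exists u; split=> [n|e e0]; first by case: (uP n).
exists (Num.truncn e^-1) => n kn; have [_ /lt_trans] := uP n; apply.
rewrite -[e]invrK ltf_pV2 ?posrE ?invr_gt0 //.
by rewrite (lt_le_trans (truncnS_gt _)) // ler_nat ltnS.
Qed.

Lemma seq_closed_closed X (A : set X) : seq_closed (@nr X) A -> closed A.
Proof. by move=> Ac x /closure_seq[u [uA ux]]; apply: Ac ux. Qed.

Lemma submod_subspace X (U : submodClosed X) : subspace [set` U].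
Proof.
by split=> [|l x y]; rewrite /= ?rpred0 // => xU yU; rewrite rpredD // rpredZ.
Qed.

Lemma closure_range_subspace X Y (T : bop X Y) : subspace (closure (range T)).
Proof.
have NP := nr_is_norm Y.
split=> [|l x y /closureP Tx /closureP Ty]; apply/closureP => e e0.
  by exists 0; [exists 0; rewrite ?linear0|rewrite subrr is_norm0].
have c0 : 0 < 2 * (cabs l + 1) by have := cabs_ge0 l; lra.
have [|_ [v _ <-] vx] := Tx (e / (2 * (cabs l + 1))); first exact: divr_gt0.
have [|_ [w _ <-] wy] := Ty (e / 2); first by rewrite divr_gt0.
exists (l *: T v + T w); first by exists (l *: v + w); rewrite ?linearP.
rewrite opprD addrACA -scalerBr (le_lt_trans (is_normD NP _ _)) //.
rewrite (is_normZ NP); suff : cabs l * nr (T v - x) <= e / 2 by lra.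
apply: le_trans (_ : (cabs l + 1) * nr (T v - x) <= _).
  by rewrite ler_wpM2r ?(is_norm_ge0 NP) //; lra.
apply: le_trans (_ : (cabs l + 1) * (e / (2 * (cabs l + 1))) <= _).
  by rewrite ler_wpM2l ?ltW //; have := cabs_ge0 l; lra.
by rewrite le_eqVlt; apply/orP; left; apply/eqP; field; lra.
Qed.

(** The [M]-component is unique, hence linear, and [complement_bound] bounds it. *)
Lemma complement_projection X (XC : seq_complete (@nr X)) (W : set X)
    (M : submodClosed X) :
  subspace W -> closed W -> topological_complement W M ->
  exists Q : bop X (subspace_of M),
    (forall x, W x -> Q x = 0) /\ forall z, Q (val z) = z.
Proof.
move=> Ws Wc [Mc WM WM0].
have NP := nr_is_norm X.
have [c c0 cP] := complement_bound NP XC Ws (submod_subspace M)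
  (closed_seq_closed Wc) (closed_seq_closed Mc) WM WM0.
have dec x : exists z : subspace_of M, W (x - val z).
  have [w [m [Ww Mm ->]]] := WM x.
  by exists (exist _ m Mm); rewrite /= addrK.
have [Q QP] := choice dec.
have Q_uniq x (z : subspace_of M) : W (x - val z) -> Q x = z.
  move=> xz; apply/val_inj/subr0_eq/WM0; last first.
    by rewrite -scaleN1r rpredD ?rpredZ //; exact: valP.
  rewrite (_ : _ - _ = (x - val z) - (x - val (Q x))); last by zmod.
  exact: subspaceB.
have Ql : linear Q.
  move=> l x y; apply: Q_uniq.
  have -> : l *: x + y - val (l *: Q x + Q y) =
      l *: (x - val (Q x)) + (y - val (Q y)).
    have -> : val (l *: Q x + Q y) = l *: val (Q x) + val (Q y) by [].
    by rewrite scalerBr; zmod.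
  by case: Ws => _ WL; apply: WL.
have Qb : nr_bounded Q.
  exists c => // x; rewrite -[X in _ * nr X](subrK (val (Q x))).
  by apply: cP => //=; exact: valP.
have [S SQ] := bop_of Ql Qb; exists S; split=> [x Wx|z]; rewrite SQ.
  by apply: Q_uniq; rewrite (subr0 x : x - val (0 : subspace_of M) = x).
by apply: Q_uniq; rewrite subrr; case: Ws.
Qed.

(** Only equivalence with a Hilbert norm is required, because [direct_sum] carries the sum of the
    norms, which in general does not come from an inner product. *)
Definition hilbertable X : Prop := seq_complete (@nr X) /\
  exists r : X -> X -> R, is_inner r /\ exists c,
    forall x, nr x <= c * hnorm r x /\ hnorm r x <= c * nr x.

Lemma surjection_of_injection X Y (J : X -> Y) :
  hilbertable X -> hilbertable Y -> linear J -> nr_bounded J ->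
  (forall x, J x = 0 -> x = 0) ->
  exists U : bop Y X, forall x, exists y, U y = x.
Proof.
move=> [XC [r [rP [c cP]]]] [YC [s [sP [d dP]]]] Jl [M M0 JM] J_inj.
have NX := nr_is_norm X; have NY := nr_is_norm Y.
have rN := hnorm_is_norm rP; have sN := hnorm_is_norm sP.
have complete Z (t : Z -> Z -> R) e : is_inner t -> seq_complete (@nr Z) ->
    (forall x, nr x <= e * hnorm t x /\ hnorm t x <= e * nr x) ->
    seq_complete (hnorm t).
  move=> tP ZC eP u uC; have tN := hnorm_is_norm tP.
  have e1 : 0 < `|e| + 1 by have := normr_ge0 e; lra.
  have le_e a b : 0 <= b -> a <= e * b -> a <= (`|e| + 1) * b.
    by move=> b0 /le_trans; apply; rewrite ler_wpM2r //; have := ler_norm e; lra.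
  have [|l ul] := ZC u.
    move=> h h0; have [|k kP] := uC (h / (`|e| + 1)); first exact: divr_gt0.
    exists k => m n /kP /[apply]; rewrite ltr_pdivlMr // mulrC.
    apply: le_lt_trans; apply: le_e; first exact: is_norm_ge0 tN _.
    by case: (eP (u m - u n)).
  exists l; apply: (lim_map (nr_is_norm Z) tN (T := id) (M := e)) ul => //.
  by move=> x; case: (eP x).
(* The product bounds [J] between the two Hilbert norms; adding 1 makes [t] invertible, and [J / t]
   is an injective contraction. *)
pose t := `|d| * M * `|c| + 1.
have t0 : 0 < t by rewrite ltr_wpDl ?mulr_ge0.
pose J' x := t^-1%:C *: J x.
have J'l : linear J'.
  by move=> l x y; rewrite /J' Jl scalerDr !scalerA mulrC.
have [x|x /eqP|U [Ul UM U_surj]] := surjection_of_contraction rP sP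
    (complete _ _ _ rP XC cP) (complete _ _ _ sP YC dP) J'l.
- rewrite (is_normZR sN) gtr0_norm ?invr_gt0 // ler_pdivrMl //.
  have [_ dJ] := dP (J x); have [cx _] := cP x.
  have hd : d * nr (J x) <= `|d| * (M * nr x).
    apply: le_trans (_ : `|d| * nr (J x) <= _); last by rewrite ler_wpM2l.
    by rewrite ler_wpM2r ?(is_norm_ge0 NY) ?ler_norm.
  have hc : nr x <= `|c| * hnorm r x.
    by apply: le_trans cx _; rewrite ler_wpM2r ?hnorm_ge0 ?ler_norm.
  apply: le_trans dJ (le_trans hd _).
  apply: le_trans (_ : `|d| * (M * (`|c| * hnorm r x)) <= _).
    by rewrite !ler_wpM2l.
  by rewrite /t !mulrA mulrDl mul1r lerDl hnorm_ge0.
- rewrite scaler_eq0 => /orP[|/eqP]; last exact: J_inj.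
  by move=> /eqP/complexI/eqP; rewrite invr_eq0 gt_eqF.
have [|S SU] := bop_of Ul.
  exists (`|c| * `|d|) => [|y]; first by rewrite mulr_ge0.
  have [cU _] := cP (U y); have [_ dy] := dP y.
  apply: le_trans cU _; rewrite -mulrA.
  apply: le_trans (_ : `|c| * hnorm r (U y) <= _).
    by rewrite ler_wpM2r ?hnorm_ge0 ?ler_norm.
  rewrite ler_wpM2l // (le_trans (UM y)) // (le_trans dy) //.
  by rewrite ler_wpM2r ?(is_norm_ge0 NY) ?ler_norm.
by exists S => x; have [y <-] := U_surj x; exists y.
Qed.

Lemma hilbert_inner (X : completeNormedModType R[i]) : is_hilbert X ->
  exists r : X -> X -> R, is_inner r /\ forall x, hnorm r x = nr x.
Proof.
move=> [f fE]; pose r x y := complex.Re (f x y).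
have rE x : r x x = nr x ^+ 2 by rewrite /r -fE nrE -rmorphXn.
have ReJ (z : R[i]) : complex.Re (Num.conj z) = complex.Re z by case: z.
exists r; split=> [|x]; last first.
  by rewrite /hnorm rE sqrtr_sqr ger0_norm // (is_norm_ge0 (nr_is_norm X)).
split=> [x y z|t x y|x y|l x y|x|x].
- by rewrite /r linearDl raddfD.
- by rewrite /r linearZl_LR /=; case: (f x y) => a b /=; rewrite mul0r subr0.
- by rewrite /r (hermC f x y) expr0 mul1r; exact: ReJ.
- by rewrite /r linearZl_LR linearZr_LR /= conjCK.
- by rewrite rE sqr_ge0.
- rewrite rE => /eqP; rewrite sqrf_eq0 => /eqP.
  exact: (is_norm_eq0 (nr_is_norm X)).
Qed.

Lemma hilbert_hilbertable (X : completeNormedModType R[i]) :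
  is_hilbert X -> hilbertable X.
Proof.
move=> /hilbert_inner[r [rP rE]]; split; first exact: nr_complete.
by exists r; split=> //; exists 1 => x; rewrite rE mul1r.
Qed.

Lemma kernel_hilbertable X Y (T : bop X Y) :
  hilbertable X -> hilbertable (subspace_of (kernel T)).
Proof.
move=> [XC [r [rP [c cP]]]]; split=> [u uC|].
  have [l ul] := XC (val \o u) uC.
  have Tl : l \in kernel T.
    rewrite inE; apply/eqP.
    apply: (lim_uniq (nr_is_norm Y) (lim_nr_map (bop_linear T) (bop_bounded T) ul)).
    apply: lim_ext (lim_cst (nr_is_norm Y) 0) => n /=.
    by have := valP (u n); rewrite inE => /eqP.
  by exists (exist _ l Tl).
exists (fun x y => r (val x) (val y)); split; last by exists c => x; exact: cP.
split=> [x y z|t x y|x y|l x y|x|x rx].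
- by rewrite raddfD innerDl.
- by rewrite linearZ innerZl.
- exact: innerC.
- by rewrite !linearZ innerJ.
- exact: inner_ge0.
- by apply/val_inj; rewrite raddf0; exact: (inner_eq0 rP).
Qed.

Section DirectSums.
Variables (I : finType) (X : I -> normedModType R[i]).

Lemma nr_direct_sum (x : direct_sum X) : nr x = \sum_i nr (x i).
Proof.
apply: complexI; rewrite -nrE direct_sum_normE rmorph_sum.
by apply: eq_bigr => i _; rewrite nrE.
Qed.

Lemma nr_coord (x : direct_sum X) i : nr (x i) <= nr x.
Proof.
rewrite nr_direct_sum (bigD1 i) //= lerDl sumr_ge0 // => j _.
exact: (is_norm_ge0 (nr_is_norm _)).
Qed.

Lemma direct_sum_complete :
  (forall i, seq_complete (@nr (X i))) -> seq_complete (@nr (direct_sum X)).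
Proof.
move=> XC u uC.
have lim i : exists l, lim_to (@nr (X i)) (u ^~ i) l.
  apply: XC => e /uC[k kP]; exists k => m n km kn.
  exact: le_lt_trans (nr_coord (u m - u n) i) (kP m n km kn).
have [l lP] := dep_choice lim.
exists (l : direct_sum X) => e e0; pose d := e / #|I|.+1%:R.
have d0 : 0 < d by rewrite divr_gt0.
have [k kP] := choice (fun i => lP i d d0).
exists (\max_i k i) => n /bigmax_leqP kn; rewrite nr_direct_sum.
apply: le_lt_trans (_ : \sum_(i : I) d < e).
  by apply: ler_sum => i _; apply/ltW/kP/kn.
rewrite sumr_const -mulr_natr -mulrA gtr_pMr // mulrC ltr_pdivrMr // mul1r.
by rewrite ltr_nat.
Qed.

Lemma direct_sum_hilbertable :
  (forall i, hilbertable (X i)) -> hilbertable (direct_sum X).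
Proof.
move=> XH; split; first by apply: direct_sum_complete => i; case: (XH i).
have [r rP] := dep_choice (fun i => proj2 (XH i)).
have [c cP] := choice (fun i => proj2 (rP i)).
have {}rP i : is_inner (r i) by case: (rP i).
pose s (x y : direct_sum X) := \sum_i r i (x i) (y i).
have sP : is_inner s.
  split=> [x y z|t x y|x y|l x y|x|x].
  - by rewrite /s -big_split; apply: eq_bigr => i _; rewrite innerDl.
  - by rewrite /s mulr_sumr; apply: eq_bigr => i _; rewrite innerZl.
  - by apply: eq_bigr => i _; rewrite innerC.
  - by apply: eq_bigr => i _; rewrite innerJ.
  - by apply: sumr_ge0 => i _; exact: inner_ge0.
  - move=> /eqP; rewrite psumr_eq0 => [/allP x0|i _]; last exact: inner_ge0.
    apply: functional_extensionality_dep => i; apply: (inner_eq0 (rP i)).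
    by apply/eqP/x0; rewrite mem_index_enum.
exists s; split=> //; exists (\sum_i `|c i|) => x; split.
- rewrite nr_direct_sum mulr_suml; apply: ler_sum => i _.
  have [ci _] := cP i (x i); apply: le_trans ci _.
  apply: le_trans (_ : `|c i| * hnorm (r i) (x i) <= _).
    by rewrite ler_wpM2r ?hnorm_ge0 ?ler_norm.
  rewrite ler_wpM2l // ler_wsqrtr // /s (bigD1 i) //= lerDl.
  by apply: sumr_ge0 => j _; exact: inner_ge0.
(* The sum [h] dominates the l^2 norm, since expanding [h * h] produces all the squares. *)
- pose h := \sum_i hnorm (r i) (x i).
  have h0 : 0 <= h by apply: sumr_ge0 => i _; exact: hnorm_ge0.
  apply: le_trans (_ : h <= _).
    rewrite -ler_sqr ?nnegrE ?hnorm_ge0 // (hnorm_sq sP) expr2 {1}/h mulr_suml.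
    apply: ler_sum => i _; rewrite -(hnorm_sq (rP i)) expr2 ler_wpM2l ?hnorm_ge0 //.
    by rewrite /h (bigD1 i) //= lerDl sumr_ge0 // => j _; exact: hnorm_ge0.
  rewrite mulr_suml; apply: ler_sum => i _.
  have [_ ci] := cP i (x i); apply: le_trans ci _.
  apply: le_trans (_ : `|c i| * nr (x i) <= _); last first.
    by rewrite ler_wpM2l // nr_coord.
  by rewrite ler_wpM2r ?ler_norm // (is_norm_ge0 (nr_is_norm _)).
Qed.

End DirectSums.
End RealNorm.

Section BoundedLinear.
Variable R : realType.
Implicit Types X Y Z : normedModType R[i].

(** Operators are assembled below as explicit functions, checked with the [bl_] lemmas and then
    packed by [bop_of_bl]. *)
Definition bounded_linear X Y (T : X -> Y) := linear T /\ nr_bounded T.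

Lemma bl_bop X Y (T : bop X Y) : bounded_linear T.
Proof. by split; [exact: bop_linear|exact: bop_bounded]. Qed.

Lemma bop_of_bl X Y (T : X -> Y) : bounded_linear T ->
  exists S : bop X Y, forall x, S x = T x.
Proof. by move=> [Tl Tb]; exact: bop_of. Qed.

Lemma bl_id X : bounded_linear (fun x : X => x).
Proof. by split=> //; exists 1 => // x; rewrite mul1r. Qed.

Lemma bl_zero X Y : bounded_linear (X := X) (Y := Y) (fun=> 0).
Proof.
split=> [a x y|]; first by rewrite scaler0 addr0.
by exists 0 => // x; rewrite mul0r (is_norm0 (nr_is_norm Y)).
Qed.

Lemma bl_comp X Y Z (T : Y -> Z) (S : X -> Y) :
  bounded_linear T -> bounded_linear S -> bounded_linear (fun x => T (S x)).
Proof.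
move=> [Tl [M M0 TM]] [Sl [L L0 SL]]; split=> [a x y|]; first by rewrite Sl Tl.
exists (M * L) => [|x]; first exact: mulr_ge0.
by rewrite (le_trans (TM _)) // -mulrA ler_wpM2l.
Qed.

Lemma bl_add X Y (T S : X -> Y) :
  bounded_linear T -> bounded_linear S -> bounded_linear (fun x => T x + S x).
Proof.
move=> [Tl [M M0 TM]] [Sl [L L0 SL]]; split=> [a x y|].
  by rewrite Sl Tl scalerDr; zmod.
exists (M + L) => [|x]; first exact: addr_ge0.
by rewrite (le_trans (is_normD (nr_is_norm Y) _ _)) // mulrDl lerD.
Qed.

Lemma bl_opp X Y (T : X -> Y) :
  bounded_linear T -> bounded_linear (fun x => - T x).
Proof.
move=> [Tl [M M0 TM]]; split=> [a x y|]; first by rewrite Tl opprD scalerN.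
by exists M => // x; rewrite (is_normN (nr_is_norm Y)).
Qed.

Lemma bl_sum X Y (I : finType) (T : I -> X -> Y) :
  (forall i, bounded_linear (T i)) -> bounded_linear (fun x => \sum_i T i x).
Proof.
move=> Tb; elim: (index_enum I) => [|i s IHs].
  under [fun x => _]funext do rewrite big_nil.
  exact: bl_zero.
under [fun x => _]funext do rewrite big_cons.
exact: bl_add.
Qed.

Definition to_sub X (U : submodClosed X) x (xU : x \in U) : subspace_of U :=
  exist _ x xU.

Lemma bl_val X (U : submodClosed X) :
  bounded_linear (val : subspace_of U -> X).
Proof. by split=> //; exists 1 => // x; rewrite mul1r. Qed.

Lemma bl_sub X Y (U : submodClosed Y) (T : X -> Y) (S : X -> subspace_of U) :
  bounded_linear T -> (forall x, val (S x) = T x) -> bounded_linear S.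
Proof.
move=> [Tl [M M0 TM]] ST; split=> [a x y|].
  by apply: val_inj; rewrite ST Tl -!ST.
by exists M => // x; rewrite (le_trans _ (TM x)) // -ST.
Qed.

Section DirectSums.
Variables (I : finType) (X : I -> normedModType R[i]).

Lemma bl_coord i : bounded_linear (fun x : direct_sum X => x i).
Proof. by split=> //; exists 1 => // x; rewrite mul1r nr_coord. Qed.

Lemma bl_pi Y (T : Y -> direct_sum X) :
  (forall i, bounded_linear (fun y => T y i)) -> bounded_linear T.
Proof.
move=> Tb; split=> [a x y|].
  by apply: functional_extensionality_dep => i; case: (Tb i) => Tl _; exact: Tl.
have bnd i : exists c, 0 <= c /\ forall y, nr (T y i) <= c * nr y.
  by case: (Tb i) => _ [c c0 cP]; exists c.
have [c cP] := choice bnd.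
exists (\sum_i c i) => [|y]; first by apply: sumr_ge0 => i _; case: (cP i).
rewrite nr_direct_sum mulr_suml; apply: ler_sum => i _.
by case: (cP i).
Qed.

Definition inj_coord i (x : X i) : direct_sum X :=
  @dfwith I (fun j => X j) (fun=> 0) i x.

Lemma inj_coord_in i (x : X i) : inj_coord x i = x.
Proof. exact: dfwithin. Qed.

Lemma inj_coord_out i j (x : X i) : i != j -> inj_coord x j = 0.
Proof. exact: dfwithout. Qed.

Lemma bl_inj_coord i : bounded_linear (@inj_coord i).
Proof.
apply: bl_pi => j; have [<-|ij] := eqVneq i j.
  under [fun x => _]funext do rewrite inj_coord_in.
  exact: bl_id.
under [fun x => _]funext do rewrite inj_coord_out //.
exact: bl_zero.
Qed.

End DirectSums.

Lemma kernel_closed X Y (T : bop X Y) : closed [set` kernel T].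
Proof.
apply: seq_closed_closed => u l uT ul; rewrite /= inE; apply/eqP.
apply: (lim_uniq (nr_is_norm Y) (lim_nr_map (bop_linear T) (bop_bounded T) ul)).
apply: lim_ext (lim_cst (nr_is_norm Y) 0) => n /=.
by have := uT n; rewrite /= inE => /eqP.
Qed.

(** * Regular operators and their generalized inverses *)

Section Regular.
Variables (X : normedModType R[i]) (E : bop X X).

Lemma right_invertible_regular : right_invertible E -> regular E.
Proof. by move=> [G EG]; exists G => x; rewrite EG. Qed.

(** For any inner inverse [G], the operator [G E G] has both properties. *)
Lemma regular_reflexive : regular E -> exists G : bop X X,
  (forall x, E (G (E x)) = E x) /\ forall x, G (E (G x)) = G x.
Proof.
move=> [G EGE].
have [H HE] := bop_of_bl (bl_comp (bl_bop G) (bl_comp (bl_bop E) (bl_bop G))).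
by exists H; split=> x; rewrite !HE ?EGE.
Qed.

(** For an inner inverse [G], the operator [E G] is a bounded projection onto the range of [E]. The
    range is thus its set of fixed points, which is closed, and its kernel is a complement. *)
Lemma regular_range : regular E ->
  closure (range E) = range E /\ complemented (closure (range E)).
Proof.
move=> [G EGE].
have [P PE] := bop_of_bl (bl_comp (bl_bop E) (bl_bop G)).
have P_range x : range E x -> P x = x by move=> [v _ <-]; rewrite PE EGE.
have rE : closure (range E) = range E.
  apply/seteqP; split; last exact: subset_closure.
  move=> x /closure_seq[u [uE ux]]; exists (G x) => //; rewrite -PE.
  have Pux := lim_nr_map (bop_linear P) (bop_bounded P) ux.
  apply: (lim_uniq (nr_is_norm X) Pux).
  by apply: lim_ext ux => n /=; rewrite P_range.
split=> //; rewrite rE; exists (kernel P : submodClosed X); split=> [|x|x].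
- exact: kernel_closed.
- exists (E (G x)), (x - E (G x)); split; last by rewrite addrC subrK.
    by exists (G x).
  by rewrite inE linearB /= !PE EGE subrr.
- by move=> /P_range Px; rewrite inE Px => /eqP.
Qed.

(** The projection is [1 - G E]. *)
Lemma kernel_projection : regular E -> exists P : bop X (subspace_of (kernel E)),
  forall x, E x = 0 -> val (P x) = x.
Proof.
move=> [G EGE].
have dP x : x - G (E x) \in kernel E by rewrite inE linearB /= EGE subrr.
pose P x : subspace_of (kernel E) := to_sub (dP x).
have [S SP] := bop_of_bl (bl_sub (S := P) (bl_add (bl_id X)
  (bl_opp (bl_comp (bl_bop G) (bl_bop E)))) (fun x => erefl)).
by exists S => x Ex; rewrite SP /= Ex linear0 subr0.
Qed.

(** One superdiagonal position: [B = T Q] sends the part of the data missed by the diagonal entry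
    into the kernel of [F], and [A = S (1 - G F)] recovers it from there. [A] ignores the range of
    [G] because [G F G = G]. *)
Lemma factor_through_kernel (Y : normedModType R[i]) (F : bop Y Y) (G : bop Y Y)
    (K : submodClosed X) (Q : bop X (subspace_of K)) :
  (forall y, F (G (F y)) = F y) -> (forall y, G (F (G y)) = G y) ->
  preceq (subspace_of K) (subspace_of (kernel F)) ->
  exists (A : bop Y X) (B : bop X Y), [/\ forall x, F (B x) = 0,
    forall y, A (G y) = 0 & forall x, A (B x) = val (Q x)].
Proof.
move=> FGF GFG [T [S ST]].
have dP y : y - G (F y) \in kernel F by rewrite inE linearB /= FGF subrr.
pose P y : subspace_of (kernel F) := to_sub (dP y).
have Pb : bounded_linear P := bl_sub (S := P) (bl_add (bl_id Y)
  (bl_opp (bl_comp (bl_bop G) (bl_bop F)))) (fun x => erefl).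
have [A AE] := bop_of_bl (bl_comp (bl_val K) (bl_comp (bl_bop S) Pb)).
have [B BE] := bop_of_bl
  (bl_comp (bl_val (kernel F)) (bl_comp (bl_bop T) (bl_bop Q))).
have FB x : F (B x) = 0.
  by rewrite BE; apply/eqP; have := valP (T (Q x)); rewrite inE.
exists A, B; split=> // [y|x]; rewrite AE.
  by rewrite (_ : P (G y) = 0) ?linear0 //; apply: val_inj; rewrite /= GFG subrr.
rewrite (_ : P (B x) = T (Q x)) ?ST //; apply: val_inj.
by rewrite /= FB linear0 subr0 BE.
Qed.

End Regular.

(** Applying [riesz] with [B = T] to the functional [r (T v) x] gives the orthogonal projection of
    [x] onto the closure of the range; the kernel of this projection is the complement. *)
Lemma hilbert_complemented (X : completeNormedModType R[i]) (T : bop X X) :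
  is_hilbert X -> complemented (closure (range T)).
Proof.
move=> /hilbert_inner[r [rP rE]].
have {rE} rE : hnorm r = @nr R X by apply/funext => x; rewrite rE.
have NP := nr_is_norm X.
have XC : seq_complete (hnorm r) by rewrite rE; exact: nr_complete.
(* The closure of the range, in the form in which [riesz] returns its point. *)
pose L z := exists u, lim_to (hnorm r) (T \o u) z.
have LP z : closure (range T) z <-> L z.
  rewrite /L rE; split=> [/closure_seq[v [vT vz]]|[u uz]].
    have [u uv] := choice (fun n => let: ex_intro2 x _ e := vT n in ex_intro _ x e).
    by exists u; apply: lim_ext vz => n /=; rewrite uv.
  by apply/closureP => e /uz[k kP]; exists (T (u k)); [exists (u k)|exact: kP].
have Llin a x y : L x -> L y -> L (a *: x + y).
  move=> [u ux] [v vy]; exists (fun n => a *: u n + v n).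
  apply: lim_ext (lim_lin (hnorm_is_norm rP) a ux vy) => n /=.
  by rewrite linearP.
have L0 : L 0.
  exists (fun=> 0); rewrite rE; apply: lim_ext (lim_cst NP 0) => n /=.
  by rewrite linear0.
(* The difference lies in the closure of the range and is orthogonal to the range, hence to
   itself. *)
have uniq z z' : L z -> L z' -> (forall v, r (T v) z = r (T v) z') -> z = z'.
  move=> Lz Lz' zz'; apply/subr0_eq/(inner_eq0 rP).
  have : L (z - z') by rewrite addrC -scaleN1r; exact: Llin.
  set w := z - z' => -[u uw].
  rewrite -[RHS](inner0l rP w).
  apply: (lim_inner_eq rP uw (lim_cst (hnorm_is_norm rP) 0)) => n /=.
  by rewrite (innerBr rP) zz' subrr inner0l.
have proj x : exists z, [/\ L z, forall v, r (T v) z = r (T v) x & nr z <= nr x].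
  have [|||z [zP zx Lz]] := riesz rP XC (bop_linear T) (psi := fun v => r (T v) x)
      _ _ (hnorm_ge0 r x).
  - by move=> v w; rewrite linearD innerDl.
  - by move=> t v; rewrite linearZ innerZl.
  - by move=> v; rewrite mulrC; exact: inner_le.
  by exists z; split=> [//|v|]; [rewrite zP|rewrite -rE].
have [P PP] := choice proj.
have PL x : L (P x) by case: (PP x).
have PE x v : r (T v) (P x) = r (T v) x by case: (PP x).
have [|S SP] := @bop_of_bl X X P.
  split; last by exists 1 => // x; rewrite mul1r; case: (PP x).
  move=> a x y; apply: uniq => [//||v]; first exact: Llin.
  rewrite PE !(innerDr rP) !(innerJr rP).
  by rewrite -(lin_mapZ (bop_linear T)) !PE.
exists (kernel S : submodClosed X); split=> [|x|x /LP Lx].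
- exact: kernel_closed.
- exists (P x), (x - P x); split; [exact/LP| |by rewrite addrC subrK].
  rewrite inE linearB /= !SP subr_eq0; apply/eqP.
  exact: (uniq _ _ (PL x) (PL (P x)) (fun v => esym (PE _ _))).
- rewrite inE SP => /eqP Px; rewrite -Px; exact: uniq.
Qed.

End BoundedLinear.

(** * Upper triangular operator matrices *)

Lemma infinite_dim_quotient (F : numFieldType) (V : lmodType F)
    (U : submodClosed V) :
  (forall x, x \in U) -> ~ infinite_dim (quotient_space U).
Proof.
(* The quotient is zero, so the empty family spans it. *)
move=> UV; apply; exists 0%N, (fun=> 0) => v; exists (fun=> 0).
rewrite big_ord0 -[LHS]reprK -[RHS]reprK; apply/eqP.
by rewrite -Quotient.idealrBE; exact: UV.
Qed.

Section Corollary.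
Variables (R : realType) (m : nat) (X : 'I_m.+1 -> normedModType R[i]).
Variables (D : forall i, bop (X i) (X i)) (l : R[i]).
Local Notation E i := (sub_scalar (D i) l).

Lemma right_invertible_sub_scalar Y (T : bop Y Y) :
  right_invertible (scalar_sub T l) <-> right_invertible (sub_scalar T l).
Proof.
by split=> -[S TS]; have [S' SE] := bop_of_bl (bl_opp (bl_bop S));
  exists S' => y; rewrite SE linearN /= -[RHS]TS /= opprB.
Qed.

Definition above_diag (A : upper_entries X) i (x : direct_sum X) : X i :=
  \sum_(j : {j : 'I_m.+1 | (i < j)%N}) A i _ (valP j) (x (val j)).

(** The rows of [T(A) - l], so that [E i] stands on the diagonal; the right spectrum is defined with
    the opposite sign. *)
Definition urow (A : upper_entries X) i (x : direct_sum X) : X i :=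
  E i (x i) + above_diag A i x.

Lemma scalar_sub_utriangular A x i :
  scalar_sub (utriangular D A) l x i = - urow A i x.
Proof.
rewrite /urow; set s := above_diag A i x.
rewrite -[E i (x i)]/(D i (x i) - l *: x i).
by rewrite -[LHS]/(l *: x i - (D i (x i) + s)); zmod.
Qed.

Lemma bl_above_diag A i : bounded_linear (above_diag A i).
Proof. by apply: bl_sum => j; exact: bl_comp (bl_bop _) (bl_coord _ _). Qed.

Lemma bl_urow A i : bounded_linear (urow A i).
Proof.
by apply: bl_add (bl_above_diag A i); exact: bl_comp (bl_bop _) (bl_coord _ _).
Qed.

Lemma right_invertible_utriangular A (S : direct_sum X -> direct_sum X) :
  bounded_linear S -> (forall y i, urow A i (S y) = y i) ->
  right_invertible (scalar_sub (utriangular D A) l).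
Proof.
move=> Sb SP; have [S' SE] := bop_of_bl (bl_opp Sb).
exists S' => y; apply: functional_extensionality_dep => i.
have [Ul _] := bl_urow A i.
by rewrite scalar_sub_utriangular SE (lin_mapN Ul) opprK SP.
Qed.

Lemma right_inverse_utriangular A :
  right_invertible (scalar_sub (utriangular D A) l) ->
  exists2 S : direct_sum X -> direct_sum X, bounded_linear S &
    forall y i, urow A i (S y) = y i.
Proof.
move=> [S SP]; exists (fun y => S (- y)).
  exact: bl_comp (bl_bop S) (bl_opp (bl_id _)).
move=> y i; rewrite -[LHS]opprK -scalar_sub_utriangular SP.
by rewrite -[LHS]/(- - y i) opprK.
Qed.

(** The last row has only its diagonal entry, so the last diagonal entry of a right inverse is a
    right inverse of [E ord_max]. *)
Lemma right_invertible_last A :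
  right_invertible (scalar_sub (utriangular D A) l) ->
  right_invertible (E ord_max).
Proof.
move=> /right_inverse_utriangular[S Sb SP].
have [G GE] := bop_of_bl
  (bl_comp (bl_coord X ord_max) (bl_comp Sb (bl_inj_coord X ord_max))).
exists G => y; rewrite GE.
have := SP (inj_coord (X := X) y) ord_max; rewrite inj_coord_in => {2}<-.
rewrite /urow /above_diag big1 ?addr0 // => -[j mj]; exfalso.
by have := ltn_ord j; rewrite ltnS leqNgt mj.
Qed.

Variable coker : forall i, bop (X i) (X i) -> submodClosed (X i).
Hypothesis cokerP : complement_choice coker.
Hypothesis XC : forall i, seq_complete (@nr R (X i)).

Lemma coker_projection i : complemented (closure (range (E i))) ->
  exists Q : bop (X i) (subspace_of (coker (E i))),
    (forall x, closure (range (E i)) x -> Q x = 0) /\ forall z, Q (val z) = z.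
Proof.
move=> /cokerP; apply: complement_projection => //.
  exact: closure_range_subspace.
exact: closed_closure.
Qed.

Lemma right_invertible_completion :
  (forall i, regular (E i)) -> right_invertible (E ord_max) ->
  (forall k : 'I_m, preceq (subspace_of (coker (E (this_idx k))))
                           (subspace_of (kernel (E (next_idx k))))) ->
  exists A : upper_entries X, right_invertible (scalar_sub (utriangular D A) l).
Proof.
move=> Ereg [Gm EGm] Kpre.
have [G GP] := dep_choice (fun i => regular_reflexive (Ereg i)).
have EGE i x : E i (G i (E i x)) = E i x by case: (GP i).
have GEG i x : G i (E i (G i x)) = G i x by case: (GP i).
have zero i j : exists Z : bop (X i) (X j), forall x, Z x = 0.
  exact: bop_of_bl (bl_zero _ _).
(* [A] is the matrix entry at (i, j) and [B] the contribution of [y i] to coordinate [j] of the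
   solution. Both vanish off the superdiagonal. *)
pose link i (P : bop (X i) (X i)) j (A : bop (X j) (X i)) (B : bop (X i) (X j)) :=
  [/\ forall x, E j (B x) = 0, forall y, A (G j y) = 0,
      forall x, A (B x) = if j == i.+1 :> nat then P x else 0 &
      j != i.+1 :> nat -> (forall y, A y = 0) /\ forall x, B x = 0].
(* [P] is the projection onto the complement of the range of [E i]. At the last index it is zero,
   since [E ord_max] is onto and no later coordinate can absorb a remainder. *)
have step i : exists P : bop (X i) (X i),
    [/\ forall y, exists v, y - P y = E i v, i = ord_max -> forall y, P y = 0 &
        forall j, exists A B, link i P j A B].
  have [->|im] := eqVneq i ord_max.
    have [Z ZE] := zero ord_max ord_max; exists Z; split=> [y|//|j].
      by exists (Gm y); rewrite EGm ZE subr0.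
    have [A AE] := zero j ord_max; have [B BE] := zero ord_max j.
    exists A, B; split=> // [x|x]; first by rewrite BE linear0.
    by rewrite AE ZE; case: ifP.
  have ik : (i < m)%N by rewrite ltn_neqAle -ltnS ltn_ord andbT -val_eqE /= in im *.
  have {ik im} [k -> {i}] : exists k : 'I_m, i = this_idx k.
    by exists (Ordinal ik); apply: val_inj.
  set i := this_idx k.
  have [rE Ecompl] := regular_range (Ereg i).
  have [Q [Q0 QK]] := coker_projection Ecompl.
  have [P PE] := bop_of_bl (bl_comp (bl_val (coker (E i))) (bl_bop Q)).
  exists P; split=> [y|ik|j].
  - have [W WM _] := cokerP Ecompl.
    have [w [x [Ew Kx ->]]] := WM y.
    have Qx : Q x = to_sub Kx by rewrite -[x]/(val (to_sub Kx)) QK.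
    rewrite PE linearD /= Q0 // add0r Qx addrK.
    by move: Ew; rewrite rE => -[v _ <-]; exists v.
  - by exfalso; have := ltn_ord k; rewrite -[k : nat]/(val i) ik ltnn.
  have [jk|jk] := eqVneq (j : nat) i.+1; last first.
    have [A AE] := zero j i; have [B BE] := zero i j.
    by exists A, B; split=> // x; rewrite ?BE ?linear0 ?AE ?(negPf jk).
  have {jk} -> : j = next_idx k by apply: val_inj.
  have [A [B [EB AG AB]]] :=
    factor_through_kernel Q (EGE (next_idx k)) (GEG (next_idx k)) (Kpre k).
  exists A, B; split=> //=.
    by move=> x; rewrite /bump /= add1n eqxx AB PE.
  by rewrite /bump /= add1n eqxx.
have [P PP] := dep_choice step.
have links i : exists AB : forall j, bop (X j) (X i) * bop (X i) (X j),
    forall j, link i (P i) j (AB j).1 (AB j).2.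
  have [_ _ L] := PP i.
  have L' j : exists AB : bop (X j) (X i) * bop (X i) (X j),
      link i (P i) j AB.1 AB.2 by have [A [B AB]] := L j; exists (A, B).
  exact: dep_choice L'.
have [AB ABP] := dep_choice links.
(* In the sum only the term [j = i - 1] can be nonzero. *)
pose S (y : direct_sum X) : direct_sum X := fun i =>
  G i (y i - P i (y i)) + \sum_j (AB j i).2 (y j).
exists (fun i j _ => (AB i j).1); apply: (@right_invertible_utriangular _ S).
  apply: bl_pi => i; apply: bl_add.
    apply: bl_comp (bl_bop _) (bl_add (bl_coord X i) (bl_opp _)).
    exact: bl_comp (bl_bop _) (bl_coord X i).
  by apply: bl_sum => j; exact: bl_comp (bl_bop _) (bl_coord X j).
move=> y i; rewrite /urow /above_diag.
have -> : E i (S y i) = y i - P i (y i).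
  rewrite (lin_mapD (bop_linear _)) linear_sum big1 => [|j _].
    have [Pi _ _] := PP i; have [v Ev] := Pi (y i).
    by rewrite addr0 Ev EGE.
  by case: (ABP j i).
(* The entry kills the range of [G j], and the only surviving correction in coordinate [j = i + 1]
   comes from [y i]. It restores the [P i (y i)] missing from [E i (S y i)]. *)
have AS j : (AB i j).1 (S y j) = if j == i.+1 :> nat then P i (y i) else 0.
  have [_ AG ABE AB0] := ABP i j.
  have [ji|ji] := eqVneq (j : nat) i.+1; last by have [-> _] := AB0 ji.
  rewrite (lin_mapD (bop_linear _)) AG add0r linear_sum (bigD1 i) //= big1 => [|k ki].
    by rewrite ABE ji eqxx addr0.
  have [_ _ _] := ABP k j; case=> [|_ ->]; last by rewrite linear0.
  by apply: contraNneq ki => jk; apply/eqP/val_inj => /=; lia.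
under eq_bigr do rewrite AS.
have [im|im] := eqVneq i ord_max.
  have [_ -> // _] := PP i; rewrite subr0 big1 ?addr0 // => j _.
  by case: ifP.
have im' : (i.+1 < m.+1)%N.
  by rewrite ltnS ltn_neqAle -ltnS ltn_ord andbT -val_eqE /= in im *.
pose j0 : {j : 'I_m.+1 | (i < j)%N} := exist _ (Ordinal im') (ltnSn i).
rewrite (bigD1 j0) //= eqxx big1 ?addr0 ?subrK // => j jj0.
case: ifP => // /eqP ji; case/negP: jj0.
by apply/eqP/val_inj/val_inj.
Qed.

Lemma regular_not_prec A (k : 'I_m) : (forall i, hilbertable (X i)) ->
  (forall i : 'I_m.+1, (0 < i)%N -> regular (E i)) ->
  complemented (closure (range (E (this_idx k)))) ->
  right_invertible (scalar_sub (utriangular D A) l) -> ~ Delta D coker k l.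
Proof.
move=> XH Ereg Ecompl /right_inverse_utriangular[S _ SP] [_ infdim].
have [Q [Q0 QK]] := coker_projection Ecompl.
(* The kernel of the block with indices above [k] is realised as the kernel of an operator on the
   whole sum that also forces the other coordinates to vanish; [kernel_hilbertable] then applies to
   it. *)
pose Phi (x : direct_sum X) : direct_sum X := fun i =>
  if (i <= k)%N then x i else urow A i x.
have [Phi' PhiE] : exists Phi' : bop (direct_sum X) (direct_sum X),
    forall x, Phi' x = Phi x.
  apply/bop_of_bl/bl_pi => i; rewrite /Phi.
  by case: (leqP i k) => _; [exact: bl_coord|exact: bl_urow].
have NP (x : direct_sum X) :
    x \in kernel Phi' <-> (forall i : 'I_m.+1, (i <= k)%N -> x i = 0) /\
                         (forall i : 'I_m.+1, (k < i)%N -> urow A i x = 0).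
  rewrite inE PhiE; split=> [x0|[x0 xA]].
    split=> i ik; have : Phi x i = 0 by rewrite x0.
      by rewrite /Phi ik.
    by rewrite /Phi leqNgt ik.
  apply: functional_extensionality_dep => i; rewrite /Phi.
  by case: leqP => ik; [exact: x0|exact: xA].
have projP (s : {s : 'I_m.+1 | (k < s)%N}) : exists P :
    bop (X (val s)) (subspace_of (kernel (E (val s)))),
    forall x, E (val s) x = 0 -> val (P x) = x.
  exact/kernel_projection/Ereg/(leq_ltn_trans _ (valP s)).
have [P PP] := dep_choice projP.
pose J (x : subspace_of (kernel Phi')) :
    direct_sum (fun s : {s : 'I_m.+1 | (k < s)%N} =>
      subspace_of (kernel (E (val s)))) := fun s => P s (val x (val s)).
have Jb : bounded_linear J.
  apply: bl_pi => s.
  exact: bl_comp (bl_bop _) (bl_comp (bl_coord X (val s)) (bl_val _)).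
have J_inj x : J x = 0 -> x = 0.
  move=> Jx; have [x0 xA] := (NP _).1 (valP x).
  pose sub (i : 'I_m.+1) (ki : (k < i)%N) : {s : 'I_m.+1 | (k < s)%N} :=
    exist _ i ki.
  have J0 s : P s (val x (val s)) = 0 by rewrite -[LHS]/(J x s) Jx.
  apply: val_inj; apply: functional_extensionality_dep => i.
  (* Downward induction on [i]: once the later coordinates vanish, row [i] gives [E i (x i) = 0], so
     [P] fixes [x i], and its value there is zero. *)
  have [n] := ubnP (m - i)%N; elim: n i => // n IHn i ni.
  have [/x0 //|ki] := leqP i k.
  have Ex : E i (val x i) = 0.
    rewrite -[RHS](xA i ki) /urow /above_diag big1 ?addr0 // => -[j ij] _ /=.
    by rewrite IHn ?linear0 //; have := ltn_ord j; lia.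
  by rewrite -(PP (sub i ki) _ Ex) (J0 (sub i ki)).
have [U U_surj] := surjection_of_injection (kernel_hilbertable Phi'
  (direct_sum_hilbertable XH))
  (direct_sum_hilbertable (fun s => kernel_hilbertable _ (XH _))) Jb.1 Jb.2 J_inj.
have [C CE] := bop_of_bl (bl_comp (bl_bop Q)
  (bl_comp (bl_above_diag A (this_idx k)) (bl_val (kernel Phi')))).
have [T TE] := bop_of_bl (bl_comp (bl_bop C) (bl_bop U)).
apply: infinite_dim_quotient (infdim T) => z.
(* Solve for the data [z] placed in coordinate [k]. The rows above [k] of [x] vanish and involve
   only coordinates above [k], so the truncation [x1] lies in the kernel of [Phi']. *)
pose y := inj_coord (X := X) (val z); pose x := S y.
pose x1 : direct_sum X := fun i => if (i <= k)%N then 0 else x i.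
have x1N : x1 \in kernel Phi'.
  apply/NP; split=> i ik; first by rewrite /x1 ik.
  have <- : y i = 0.
    apply: inj_coord_out; apply/eqP => ki; move: ik; rewrite -ki /=; lia.
  rewrite -(SP y i) /urow /above_diag /x1 leqNgt ik /=; congr (_ + _).
  by apply: eq_bigr => -[j ij] _ /=; rewrite leqNgt (ltn_trans ik ij).
have [h Uh] := U_surj (to_sub x1N).
rewrite !inE /=; exists h => //.
have above_x1 : above_diag A (this_idx k) x1 = above_diag A (this_idx k) x.
  by apply: eq_bigr => -[j kj] _; rewrite /x1 leqNgt kj.
(* Row [k] reads [E k (x k)] plus the off-diagonal sum equals [z]; [Q] kills the first term and
   fixes [z]. *)
rewrite TE Uh CE -[val _]/x1 above_x1 -[RHS]QK.
have := SP y (this_idx k); rewrite {2}/y inj_coord_in => <-.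
rewrite (lin_mapD (bop_linear Q)) (Q0 (E _ _)) ?add0r //.
by apply: subset_closure; exists (x (this_idx k)).
Qed.

End Corollary.

Theorem corollary2p9 (R : realType) (m : nat) (m_gt0 : (0 < m)%N)
  (X : 'I_m.+1 -> completeNormedModType R[i])
  (D : forall i, bop (X i) (X i))
  (coker : forall i, bop (X i) (X i) -> submodClosed (X i))
  (cokerP : complement_choice coker)
  (D_regular : forall s : 'I_m.+1, (0 < s < m)%N ->
     forall l : R[i], regular (sub_scalar (D s) l)) :
  \bigcap_(A in [set: upper_entries X]) right_spectrum (utriangular D A)
    `<=` right_spectrum (D ord_max)
         `|` (\bigcup_(k in [set: 'I_m]) Delta' D coker k) `|` Delta'' D
  /\
  ((forall i, is_hilbert (X i) /\ infinite_dim (X i)) ->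
   right_spectrum (D ord_max) `|` (\bigcup_(k in [set: 'I_m]) Delta D coker k)
     `<=` \bigcap_(A in [set: upper_entries X])
            right_spectrum (utriangular D A)).
Proof.
(* The hypothesis covers the interior indices; at the last one, right invertibility supplies
   regularity. *)
have regular_pos l : right_invertible (sub_scalar (D ord_max) l) ->
    forall i : 'I_m.+1, (0 < i)%N -> regular (sub_scalar (D i) l).
  move=> Em i i0; have [->|im] := eqVneq i ord_max.
    exact: right_invertible_regular.
  apply: D_regular; rewrite i0 /= ltn_neqAle -ltnS ltn_ord andbT.
  by rewrite -val_eqE in im.
split=> [l lA|XH l lD A _ Tl].
  apply: contrapT => /not_orP[/not_orP[nlm nlK] nlE].
  have Em := (right_invertible_sub_scalar l _).1 (contrapT nlm).
  have Ereg i : regular (sub_scalar (D i) l).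
    have [i0|] := posnP i; last exact: regular_pos.
    by rewrite (_ : i = ord0); [exact: contrapT|exact: val_inj].
  have [|A TA] := right_invertible_completion cokerP
    (fun i => @nr_complete R (X i)) Ereg Em.
    by move=> k; apply: contrapT => nk; apply: nlK; exists k.
  exact: lA A I TA.
have Em := right_invertible_last Tl.
case: lD => [|[k _]]; first by apply; exact/right_invertible_sub_scalar.
apply: (regular_not_prec cokerP (fun i => @nr_complete R (X i)) _ _ _ Tl).
- by move=> i; apply: hilbert_hilbertable; case: (XH i).
- exact: regular_pos.
(* For [k = 0] the operator may fail to be regular, so the complement comes from the Hilbert
   structure. *)
- by apply: hilbert_complemented; case: (XH (this_idx k)).
Qed.
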